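(* Let $\mathcal{U}=\{(K,r)\in\mathbf{K}\times(0;1):\exists z\in2^\omega\,(\mathcal{D}_K(z)=r)\}$ and $\mathcal{U}^{c}=(\mathbf{K}\times(0;1))\setminus\mathcal{U}$; for $K\in\mathbf{K}$ let $\mathcal{U}_K=\{r:(K,r)\in\mathcal{U}\}$ and $\mathcal{U}^c_K=\{r:(K,r)\in\mathcal{U}^c\}$. Then: (a) $\mathcal{U}$ is (lightface) $\Sigma^1_1$ and is universal for the analytic subsets of $(0;1)$, i.e. $\{\mathcal{U}_K:K\in\mathbf{K}\}$ is exactly the family of analytic subsets of $(0;1)$; hence $\mathcal{U}^c$ is (lightface) $\Pi^1_1$ and universal for the coanalytic subsets of $(0;1)$. (b) Every analytic $S\subseteq(0;1)$ is of the form $\mathcal{U}_K$ with $K$ solid, and every coanalytic $P\subseteq(0;1)$ is of the form $\mathcal{U}^c_K$ with $K$ solid. (c) $\mathcal{U}\cap((\mathrm{Sld}\cap\mathrm{Rng}_{\mathrm{inj}})\times(0;1))$ parametrizes the Borel subsets of $(0;1)$, i.e. $\{\mathcal{U}_K:K\in\mathbf{K}\cap\mathrm{Sld}\cap\mathrm{Rng}_{\mathrm{inj}}\}$ is exactly the family of Borel subsets of $(0;1)$; and $\mathcal{U}^c\cap((\mathrm{Sld}\cap\mathrm{Rng}_{\mathrm{inj}})\times(0;1))$ is (lightface) $\Pi^1_1$ and parametrizes the Borel subsets of $(0;1)$.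
   Context: $2^{\omega}$ is the Cantor space; $N_s=\{x\in2^\omega:s\subset x\}$; $\mu$ is the coin-tossing measure, $\mu(N_s)=2^{-\mathrm{lh}(s)}$. For measurable $A$, $\mathcal{D}_A(z)=\lim_n\mu(A\cap N_{z\restriction n})/\mu(N_{z\restriction n})$ when the limit exists. $\mathbf{K}$ is the Polish space of compact subsets of $2^\omega$ with the Vietoris topology; all spaces carry their standard recursive presentations, so lightface classes make sense. $\mathrm{Sld}$ is the class of solid sets, i.e. sets $A$ for which $\mathcal{D}_A(z)$ exists for every $z$. $\mathrm{Rng}_{\mathrm{inj}}$ is the class of measurable $A$ such that for all $z_1,z_2$, $\mathcal{D}_A(z_1)=\mathcal{D}_A(z_2)\in(0;1)$ implies $z_1=z_2$. *)

(* Defs.v *)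
From HB Require Import structures.
From mathcomp Require Import all_boot all_order all_algebra.
From mathcomp Require Import all_classical all_reals all_analysis.
Set Implicit Arguments. Unset Strict Implicit. Unset Printing Implicit Defensive.
Import Order.TTheory GRing.Theory Num.Theory.
Import numFieldNormedType.Exports.
Local Open Scope classical_set_scope.
Local Open Scope ring_scope.

Definition restr (z : cantor_space) (n : nat) : seq bool := mkseq z n.

Definition Nbhd (s : seq bool) : set cantor_space :=
  [set z | restr z (size s) = s].

(** The coin-tossing (outer) measure: mu(A) = inf of sum_i 2^-lh(s_i) over
    countable covers of A by basic sets N_(s_i).  On Borel (in particular
    compact) sets this is the coin-tossing measure mu(N_s) = 2^-lh(s). *)
Definition mu_out (R : realType) (A : set cantor_space) : \bar R :=
  ereal_inf [set (\sum_(0 <= i <oo) (((2%:R : R) ^- size (s i))%:E))%E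
            | s in [set s : nat -> seq bool | A `<=` \bigcup_i Nbhd (s i)]].

(** mu(A cap N_(z|n)) / mu(N_(z|n)) *)
Definition dens_seq (R : realType) (A : set cantor_space) (z : cantor_space)
  (n : nat) : R :=
  fine (mu_out R (A `&` Nbhd (restr z n))) * (2%:R : R) ^+ n.

Definition DensityIs (R : realType) (A : set cantor_space) (z : cantor_space)
  (r : R) : Prop :=
  dens_seq R A z n @[n --> \oo] --> r.

Definition Sld (R : realType) (A : set cantor_space) : Prop :=
  forall z, exists r : R, DensityIs A z r.

Definition Rng_inj (R : realType) (A : set cantor_space) : Prop :=
  forall (z1 z2 : cantor_space) (r : R),
    DensityIs A z1 r -> DensityIs A z2 r -> 0 < r < 1 -> z1 = z2.

(** Points of the hyperspace K are the compact subsets of cantor_space.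
    U = {(K,r) in K x (0;1) | exists z, D_K(z) = r}, as a predicate. *)
Definition U (R : realType) (K : set cantor_space) (r : R) : Prop :=
  0 < r < 1 /\ exists z, DensityIs K z r.

Definition Uc (R : realType) (K : set cantor_space) (r : R) : Prop :=
  0 < r < 1 /\ ~ U K r.

Definition Usec (R : realType) (K : set cantor_space) : set R := [set r | U K r].
Definition Ucsec (R : realType) (K : set cantor_space) : set R := [set r | Uc K r].

Definition baire_continuous (R : realType) (f : (nat -> nat) -> R) : Prop :=
  forall (x : nat -> nat) (e : R), 0 < e ->
    exists n : nat, forall y : nat -> nat,
      (forall i, (i < n)%N -> y i = x i) -> `|f y - f x| < e.

Definition analytic01 (R : realType) (S : set R) : Prop :=
  S `<=` (`]0, 1[ : set R) /\
  (S = set0 \/ (exists f : (nat -> nat) -> R, (baire_continuous f /\ f @` setT = S))).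

Definition coanalytic01 (R : realType) (P : set R) : Prop :=
  P `<=` (`]0, 1[ : set R) /\ analytic01 (`]0, 1[ `\` P).

Definition borel01 (R : realType) (B : set R) : Prop :=
  B `<=` (`]0, 1[ : set R) /\ <<s (@open R) >> B.

Definition npair (a b : nat) : nat := (2 ^ a * (b.*2).+1).-1.
Definition nfst (n : nat) : nat := logn 2 n.+1.
Definition nsnd (n : nat) : nat := ((n.+1 %/ 2 ^ nfst n).-1)./2.
Fixpoint scode (s : seq nat) : nat :=
  match s with [::] => 0 | a :: t => (npair a (scode t)).+1 end.
Definition bcode (s : seq bool) : nat := scode (map nat_of_bool s).

(** enumeration of the rationals (surjective onto Q), embedded in R *)
Definition qdec (R : realType) (n : nat) : R :=
  ((nfst n)%:R - (nfst (nsnd n))%:R) / ((nsnd (nsnd n)).+1)%:R.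

Inductive PRF : Type :=
| PRzero : PRF
| PRsucc : PRF
| PRproj : nat -> PRF
| PRcomp : PRF -> seq PRF -> PRF
| PRrec : PRF -> PRF -> PRF.

Fixpoint prf_eval (f : PRF) (args : seq nat) {struct f} : nat :=
  match f with
  | PRzero => 0
  | PRsucc => (head 0 args).+1
  | PRproj i => nth 0 args i
  | PRcomp g hs =>
      prf_eval g ((fix evs (l : seq PRF) : seq nat :=
                     match l with
                     | [::] => [::]
                     | h :: t => prf_eval h args :: evs t
                     end) hs)
  | PRrec g h =>
      let rest := behead args in
      (fix it (n : nat) : nat :=
         match n with
         | 0 => prf_eval g rest
         | k.+1 => prf_eval h [:: k, it k & rest]
         end) (head 0 args)
  end.

(** Names (recursive presentations):
    - a compact K is named by the characteristic function of its tree
      {s | N_s meets K}  (this represents the Vietoris topology);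
    - a real r is named by a Cauchy sequence of rationals with
      |q_n - r| <= 2^-n;
    - a pair (K, r) by the interleaving of the two names. *)
Definition is_Kname (K : set cantor_space) (x : nat -> nat) : Prop :=
  (forall s : seq bool,
      x (bcode s) = (if `[< K `&` Nbhd s !=set0 >] then 1 else 0)%N) /\
  (forall n, (forall s, bcode s <> n) -> x n = 0%N).

Definition is_Rname (R : realType) (r : R) (y : nat -> nat) : Prop :=
  forall n, `|qdec R (y n) - r| <= (2%:R : R) ^- n.

Definition is_name (R : realType) (K : set cantor_space) (r : R)
  (w : nat -> nat) : Prop :=
  is_Kname K (fun n => w n.*2) /\ is_Rname r (fun n => w n.*2.+1).

(** Lightface Sigma^1_1 subsets of K x R:  the set of names of its points is
    (on the set of names) of the Kleene normal form
    {w | exists v, forall n, P(<w|n>, <v|n>)} with P (primitive) recursive. *)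
Definition Sigma11 (R : realType) (A : set cantor_space -> R -> Prop) : Prop :=
  exists f : PRF, forall (K : set cantor_space) (r : R) (w : nat -> nat),
    compact K -> is_name K r w ->
    (A K r <-> exists v : nat -> nat, forall n : nat,
        prf_eval f [:: scode (mkseq w n); scode (mkseq v n)] != 0%N).

Definition Pi11 (R : realType) (A : set cantor_space -> R -> Prop) : Prop :=
  Sigma11 (fun K r => ~ A K r).

(* Main.v *)
(** The density of a compact [K] in [N_s] is the limit of the proportion of the extensions of
    [s] of length [n] that meet [K]; so [D_K(z) = r] is arithmetical in the tree of [K], which
    gives the lightface complexity, and [U_K] is a continuous image of a closed set.  If
    [D_K] takes no value of (0;1) twice, the sets of values taken on the sets [N_s] of a given
    length are disjoint analytic sets; Borel sets separating them locate the point where a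
    value is taken, so [U_K] is Borel.

    Conversely, let node values [tau s] in [0;1] converge along every branch [y] to [g y].
    Let [K] be the set of the doubled points [y0 y0 y1 y1 ...] together with, at each point
    where a sequence of bits stops being doubled, a clopen set whose relative measure is a
    slowly varying average of [tau].  Then [K] has density [g y] at the doubled [y], and
    density 0 or 1 elsewhere.  For a continuous [h] on a closed set [C] of Baire space, coding
    the points of [C] by branches yields such a [tau] for which the values of [g] in (0;1) are
    those of [h], with the same injectivity.  Finally, analytic sets are images of this
    kind, and Borel sets are images under injective [h]. *)
Require Import Defs.
From HB Require Import structures.
From mathcomp Require Import all_boot all_order all_algebra.
From mathcomp Require Import all_classical all_reals all_analysis.
From mathcomp Require Import ring lra zify.
Set Implicit Arguments. Unset Strict Implicit. Unset Printing Implicit Defensive.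
Import Order.TTheory GRing.Theory Num.Theory.
Import numFieldNormedType.Exports.
Local Open Scope classical_set_scope.
Local Open Scope ring_scope.

(** * Densities and the tree of a compact set *)

(** Solidity asks for a density at every point of a compact space, while Baire space is not compact:
    a branch that stops coding still needs a limit. Hence every node of the coding carries a default
    point of [C], coded by the branch that stays at the node forever; branches making an illegal
    move die and get the limit 0, which lies outside (0;1). Defaults create several routes to one
    point, so the moves are restricted until each point has exactly one code, as the Borel case
    requires.

    The averaging of [tau] is forced by the shape of [K]: half of the measure below a doubled node
    sits where doubling stops at that node, the other half mixes the values of all deeper nodes. The
    density follows the values along a single branch only if neighbouring values differ little.

    For the complexity, [Sigma11] offers one existential function. Points, moduli of convergence and
    counts in the tree are packed into it, and the formula merely checks them. Failure of solidity
    and failure of injectivity can be witnessed in the same way. *)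

Lemma NbhdP (s : seq bool) (z : cantor_space) :
  Nbhd s z <-> forall i, (i < size s)%N -> z i = nth false s i.
Proof.
split=> [<- i|h]; rewrite /restr.
  by rewrite size_mkseq => ilt; rewrite nth_mkseq.
apply: (@eq_from_nth _ false); rewrite size_mkseq // => i ilt.
by rewrite nth_mkseq // h.
Qed.

Lemma Nbhd_restr (z : cantor_space) n : Nbhd (restr z n) z.
Proof. by rewrite /Nbhd /= size_mkseq. Qed.

Lemma restrS (z : cantor_space) n : restr z n.+1 = rcons (restr z n) (z n).
Proof. exact: mkseqS. Qed.

Lemma Nbhd_restrP (z : cantor_space) n (y : cantor_space) :
  Nbhd (restr z n) y <-> forall i, (i < n)%N -> y i = z i.
Proof.
rewrite NbhdP size_mkseq; split=> h i ilt; first by rewrite h // nth_mkseq.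
by rewrite h // nth_mkseq.
Qed.

Lemma Nbhd_rcons (s : seq bool) (b : bool) (z : cantor_space) :
  Nbhd (rcons s b) z <-> Nbhd s z /\ z (size s) = b.
Proof.
rewrite /Nbhd /= size_rcons restrS; split=> [/eqP|[-> ->]] //.
by rewrite eqseq_rcons => /andP[/eqP-> /eqP->].
Qed.

Lemma open_Nbhd (s : seq bool) : open (Nbhd s : set cantor_space).
Proof.
elim/last_ind: s => [|s b IH].
  rewrite (_ : Nbhd _ = setT); first exact: openT.
  by apply/seteqP; split.
rewrite (_ : Nbhd _ = Nbhd s `&` (fun z : cantor_space => z (size s)) @^-1` [set b]).
  apply: openI => //; apply: open_comp; last exact: discrete_open.
  by move=> z _; exact: (@proj_continuous nat (fun=> bool) (size s) z).
by apply/seteqP; split=> z /=; rewrite ?Nbhd_rcons.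
Qed.

Lemma closed_Nbhd (s : seq bool) : closed (Nbhd s : set cantor_space).
Proof.
rewrite -openC (_ : ~` _ = \bigcup_(t in [set t | size t = size s /\ t <> s]) Nbhd t).
  by apply: bigcup_open => t _; exact: open_Nbhd.
apply/seteqP; split=> z /=.
  move=> h; exists (restr z (size s)); last exact: Nbhd_restr.
  by split; [rewrite size_mkseq | exact: h].
by move=> [t [ts ne]]; rewrite /Nbhd /= ts => zt; rewrite zt.
Qed.

(** * Densities of compact sets as limits of counts *)

Section Density.
Variable R : realType.
Implicit Types (A K : set cantor_space) (s t : seq bool) (l : seq (seq bool)).

Definition hp (n : nat) : R := 2%:R ^- n.

Lemma hp_gt0 n : 0 < hp n. Proof. by rewrite /hp invr_gt0 exprn_gt0. Qed.
Lemma hp_ge0 n : 0 <= hp n. Proof. exact: ltW (hp_gt0 n). Qed.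
Lemma hp0 : hp 0 = 1. Proof. by rewrite /hp expr0 invr1. Qed.
Lemma hpS n : hp n = hp n.+1 + hp n.+1.
Proof.
rewrite /hp exprS invfM -mulrDl (_ : _ + _ = 1) ?mul1r //.
by rewrite -div1r -splitr.
Qed.
Lemma hpD m n : hp (m + n) = hp m * hp n.
Proof. by rewrite /hp exprD invfM. Qed.
Lemma hpK n : hp n * 2%:R ^+ n = 1.
Proof. by rewrite /hp mulVf // expf_neq0. Qed.
Lemma hp_le m n : (m <= n)%N -> hp n <= hp m.
Proof.
by move=> mn; rewrite /hp lef_pV2 ?posrE ?exprn_gt0 // ler_weXn2l // ler1n.
Qed.
Lemma hp_le1 n : hp n <= 1. Proof. by rewrite -hp0; exact: hp_le. Qed.
Lemma hp_arch (e : R) : 0 < e -> exists n, hp n < e.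
Proof.
move=> e0; have [N _ h] := near_infty_natSinv_expn_lt (PosNum e0).
by exists N; have := h N (leqnn N); rewrite /= mul1r.
Qed.

Definition cover_weight l : R := \sum_(t <- l) hp (size t).

(** [mu_out] sees infinite covers only. A finite cover is continued by strings of lengths [k+1],
    [k+2], ..., whose weights add up to at most [hp k]. *)
Definition pad l k i : seq bool :=
  if (i < size l)%N then nth [::] l i else nseq (i - size l + k.+1) false.

Lemma pad_sum l k m :
  \sum_(0 <= i < m) hp (size (pad l k i)) <= cover_weight l + hp k.
Proof.
rewrite /cover_weight.
elim: l m => [m|t l IH [|m]].
- rewrite big_nil add0r.
  have -> : \sum_(0 <= i < m) hp (size (pad [::] k i)) = hp k - hp (m + k).
    elim: m => [|m IH]; first by rewrite big_geq // subrr.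
    rewrite big_nat_recr //= IH /pad /= subn0 size_nseq addnS addSn.
    by rewrite (hpS (m + k)); ring.
  by rewrite gerBl hp_ge0.
- rewrite big_geq // addr_ge0 ?hp_ge0 // sumr_ge0 // => *; exact: hp_ge0.
- by rewrite big_nat_recl // big_cons -addrA lerD2l; exact: IH.
Qed.

Lemma mu_out_ge0 A : (0%:E <= mu_out R A)%E.
Proof.
apply: le_ereal_inf_tmp => _ [s _ <-].
by apply: nneseries_ge0 => i _ _; rewrite lee_fin hp_ge0.
Qed.

Lemma mu_out_le_cover A l :
  A `<=` [set z | exists2 t, t \in l & Nbhd t z] ->
  (mu_out R A <= (cover_weight l)%:E)%E.
Proof.
move=> Al; apply/lee_addgt0Pr => e /hp_arch[k ke].
apply: (@le_trans _ _ (cover_weight l + hp k)%:E); last first.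
  by rewrite -EFinD lee_fin lerD2l ltW.
apply: (@le_trans _ _ (\sum_(0 <= i <oo) (hp (size (pad l k i)))%:E)%E).
  apply: ereal_inf_lbound; exists (pad l k) => //=.
  move=> z /Al[t tl tz]; exists (index t l) => //.
  by rewrite /pad index_mem tl nth_index.
apply: lime_le.
  by apply: is_cvg_nneseries => i _ _; rewrite lee_fin hp_ge0.
by apply: nearW => m; rewrite sumEFin lee_fin; exact: pad_sum.
Qed.

Definition met K s : bool := `[< K `&` Nbhd s !=set0 >].

Fixpoint cnt K s (j : nat) : nat :=
  if j is j'.+1 then (cnt K (rcons s false) j' + cnt K (rcons s true) j')%N
  else met K s.

Definition freq K s j : R := (cnt K s j)%:R * hp j.

Definition tree K s j : seq (seq bool) :=
  (fix F s j := if j is j'.+1 then F (rcons s false) j' ++ F (rcons s true) j'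
   else if met K s then [:: s] else [::]) s j.

Lemma tree_cover K s j :
  K `&` Nbhd s `<=` [set z | exists2 t, t \in tree K s j & Nbhd t z].
Proof.
elim: j s => [|j IH] s z [Kz sz] /=.
  rewrite /= (_ : met K s); last by apply/asboolP; exists z.
  by exists s; rewrite ?inE.
have zb : Nbhd (rcons s (z (size s))) z by apply/Nbhd_rcons.
have [t tin tz] := IH _ z (conj Kz zb).
by exists t => //; rewrite mem_cat; case: (z _) tin => -> //; rewrite orbT.
Qed.

Lemma tree_weight K s j :
  cover_weight (tree K s j) = (cnt K s j)%:R * hp (size s + j).
Proof.
rewrite /cover_weight; elim: j s => [|j IH] s /=.
  by case: (met K s); rewrite ?big_nil ?big_seq1 ?addn0 ?mul1r ?mul0r.
by rewrite big_cat /= !IH natrD !size_rcons !addSn addnS mulrDl.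
Qed.

(** The measure of the intersection of [Nbhd s] and [Nbhd t]. *)
Definition wt s t : R :=
  if prefix t s then hp (size s) else if prefix s t then hp (size t) else 0.

Lemma wt_ge0 s t : 0 <= wt s t.
Proof. by rewrite /wt; do 2?case: ifP => _ //; exact: hp_ge0. Qed.

Lemma wt_le s t : wt s t <= hp (size t).
Proof.
rewrite /wt; case: ifP => [/prefixP[u ->]|_]; last by case: ifP => // _; exact: hp_ge0.
by rewrite size_cat; apply: hp_le; exact: leq_addr.
Qed.

Lemma prefix_rconsE (s t : seq bool) b :
  prefix t (rcons s b) = prefix t s || (t == rcons s b).
Proof.
apply/idP/orP => [/prefixP[u]|[/prefixP[u ->]|/eqP->]].
- elim/last_ind: u => [|u c _]; first by rewrite cats0 => ->; right.
  rewrite -rcons_cat => /eqP; rewrite eqseq_rcons => /andP[/eqP-> _].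
  by left; exact: prefix_prefix.
- by rewrite -cats1 -catA prefix_prefix.
- exact: prefix_refl.
Qed.

Lemma wt_split s t : wt (rcons s false) t + wt (rcons s true) t <= wt s t.
Proof.
rewrite /wt !prefix_rconsE !size_rcons.
case: (boolP (prefix t s)) => [_|ts] /=; first by rewrite -(hpS (size s)).
case: (boolP (prefix s t)) => [/prefixP[u tE]|pst]; last first.
  have np b : prefix (rcons s b) t = false.
    by apply/negbTE/negP => /prefixP[u tE]; move: pst; rewrite tE -cats1 -catA prefix_prefix.
  have ne b : (t == rcons s b) = false.
    by apply/eqP => tE; move: (np b); rewrite tE prefix_refl.
  by rewrite !np !ne addr0.
case: u tE => [|b u] tE; first by move: ts; rewrite tE cats0 prefix_refl.
have {tE}tE : t = rcons s b ++ u by rewrite tE -cats1 -catA.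
have pr c : prefix (rcons s c) t = (c == b).
  by rewrite tE prefixE take_size_cat ?size_rcons // eqseq_rcons eqxx eq_sym.
have ne c : c != b -> (t == rcons s c) = false.
  by move=> cb; apply/negP => /eqP tc; move: (pr c); rewrite tc prefix_refl (negbTE cb).
have eqb : (if t == rcons s b then hp (size s).+1 else hp (size t)) = hp (size t).
  by case: eqP => // ->; rewrite size_rcons.
rewrite !pr; clear tE pr; case: b ne eqb => ne eqb; rewrite eqb.
  by rewrite (ne false) //= add0r.
by rewrite (ne true) //= addr0.
Qed.

(** The counted nodes are at least as long as every string of [l], so a node meeting [K] extends a
    member of [l], which then contributes the whole measure of the node. The induction shares the
    weight of [l] between the two halves of [Nbhd s]. *)
Lemma cnt_le_weight K l j s : (forall t, t \in l -> (size t <= size s + j)%N) ->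
  K `&` Nbhd s `<=` [set z | exists2 t, t \in l & Nbhd t z] ->
  (cnt K s j)%:R * hp (size s + j) <= \sum_(t <- l) wt s t.
Proof.
elim: j s => [|j IH] s sz cov /=.
  rewrite addn0 /met; case: asboolP => [[z [Kz sz0]]|_]; last first.
    by rewrite mul0r sumr_ge0 // => *; exact: wt_ge0.
  have [t tl tz] := cov _ (conj Kz sz0).
  rewrite mul1r (big_rem t tl) /= /wt.
  have -> : prefix t s.
    have lts : (size t <= size s)%N by rewrite -[size s]addn0 sz.
    apply/prefixP; exists (drop (size t) s); rewrite -{1}(cat_take_drop (size t) s).
    congr (_ ++ _); apply: (@eq_from_nth _ false); rewrite size_takel // => i ilt.
    move/NbhdP: tz => <- //; rewrite nth_take //.
    by move/NbhdP: sz0 => -> //; exact: leq_trans lts.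
  by rewrite lerDl sumr_ge0 // => *; exact: wt_ge0.
have H b : (cnt K (rcons s b) j)%:R * hp (size s + j.+1) <= \sum_(t <- l) wt (rcons s b) t.
  rewrite addnS -addSn -(size_rcons s b); apply: IH.
    by move=> t /sz; rewrite size_rcons addSn addnS.
  by move=> z [Kz /Nbhd_rcons[zs _]]; exact: cov.
rewrite natrD mulrDl; apply: le_trans (lerD (H _) (H _)) _.
by rewrite -big_split /=; apply: ler_sum => t _; exact: wt_split.
Qed.

Definition dens A s : R := fine (mu_out R (A `&` Nbhd s)) * 2%:R ^+ size s.

Lemma dens_seqE A (z : cantor_space) n : dens_seq R A z n = dens A (restr z n).
Proof. by rewrite /dens_seq /dens size_mkseq. Qed.

Lemma mu_fin K s : mu_out R (K `&` Nbhd s) \is a fin_num.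
Proof.
rewrite ge0_fin_numE ?mu_out_ge0 //.
exact: le_lt_trans (mu_out_le_cover (@tree_cover K s 0)) (ltry _).
Qed.

Lemma dens_ge0 K s : 0 <= dens K s.
Proof. by rewrite /dens mulr_ge0 ?exprn_ge0 // fine_ge0 // mu_out_ge0. Qed.

Lemma dens_le_freq K s j : dens K s <= freq K s j.
Proof.
have := mu_out_le_cover (@tree_cover K s j).
rewrite tree_weight -(fineK (mu_fin K s)) lee_fin hpD => h.
rewrite /dens; apply: le_trans (ler_wpM2r _ h) _; first by rewrite exprn_ge0.
by rewrite /freq -!mulrA [hp j * _]mulrC (mulrA (hp (size s))) hpK mul1r.
Qed.

Lemma freq0 K s : freq K s 0 = (met K s)%:R.
Proof. by rewrite /freq hp0 mulr1. Qed.

Lemma freqS K s j :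
  freq K s j.+1 = (freq K (rcons s false) j + freq K (rcons s true) j) / 2%:R.
Proof.
rewrite /freq /= natrD -mulrDl -mulrA; congr (_ * _).
by rewrite (hpS j) mulrDl -splitr.
Qed.

Lemma met_rcons K s b : met K (rcons s b) -> met K s.
Proof. by move=> /asboolP[z [Kz /Nbhd_rcons[zs _]]]; apply/asboolP; exists z. Qed.

Lemma freq_noninc K s i j : (i <= j)%N -> freq K s j <= freq K s i.
Proof.
move=> ij; rewrite -(subnK ij); elim: (j - i)%N => // k IH.
rewrite addSn; apply: le_trans IH; move: (k + i)%N => {i j ij k} j.
elim: j s => [|j IH] s; last first.
  by rewrite freqS [leRHS]freqS ler_pM2r ?invr_gt0 // lerD.
rewrite freqS !freq0; have := @met_rcons K s false; have := @met_rcons K s true.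
by case: (met K s); case: (met K (rcons s _)); case: (met K (rcons s _)) => //=;
  rewrite -?[(true : R)]/1 => h1 h2; try (by have := h1 isT); try (by have := h2 isT); lra.
Qed.

(** Compactness reduces an almost optimal infinite cover to finitely many strings; counting at the
    greatest of their lengths gives at most the weight of the cover. *)
Lemma freq_lt_dens K s (e : R) : compact K -> 0 < e ->
  exists j, freq K s j < dens K s + e.
Proof.
move=> cK e0.
have e'0 : 0 < e * hp (size s) by rewrite mulr_gt0 ?hp_gt0.
have := lb_ereal_inf_adherent e'0 (mu_fin K s).
move=> [_ [c /= cov <-]]; rewrite -/(mu_out R _) => clt.
have cKs : compact (K `&` Nbhd s) by apply: compact_closedI => //; exact: closed_Nbhd.
move: cKs; rewrite compact_cover => /(_ nat setT (fun i => Nbhd (c i))).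
case=> [i _||D _ Dcov]; [exact: open_Nbhd|exact: cov|].
pose n := (\max_(i <- finmap.enum_fset D) i).+1.
pose l := [seq c i | i <- iota 0 n].
pose j := \max_(i < n) size (c i).
exists j.
have lcov : K `&` Nbhd s `<=` [set z | exists2 t, t \in l & Nbhd t z].
  move=> z /Dcov[i /= iD zi]; exists (c i) => //; apply: map_f.
  by rewrite mem_iota add0n ltnS /= (big_rem i) //= leq_maxl.
have szl t : t \in l -> (size t <= size s + j)%N.
  move=> /mapP[i]; rewrite mem_iota add0n => /= ilt ->.
  apply: leq_trans (leq_addl _ _); rewrite /j.
  exact: (leq_bigmax (Ordinal ilt)).
have h1 := cnt_le_weight szl lcov.
have h2 : \sum_(t <- l) wt s t <= \sum_(0 <= i < n) hp (size (c i)).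
  rewrite /l big_map /index_iota subn0; apply: ler_sum => i _; exact: wt_le.
have h3 : (((cnt K s j)%:R * hp (size s + j))%:E <
    mu_out R (K `&` Nbhd s) + (e * hp (size s))%:E)%E.
  apply: le_lt_trans clt.
  apply: (@le_trans _ _ (\sum_(0 <= i < n) (hp (size (c i)))%:E)%E).
    by rewrite sumEFin lee_fin (le_trans h1).
  by apply: nneseries_lim_ge => i _; rewrite lee_fin hp_ge0.
move: h3; rewrite -(fineK (mu_fin K s)) -EFinD lte_fin hpD => h3.
have p2 : 0 < (2%:R : R) ^+ size s by rewrite exprn_gt0.
move: h3; rewrite -(ltr_pM2r p2) mulrDl -/(dens K s) -[e * _ * _]mulrA hpK mulr1.
by rewrite mulrCA mulrAC hpK mul1r.
Qed.

Lemma freq_near_dens K s (e : R) : compact K -> 0 < e ->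
  exists J, forall j, (J <= j)%N -> `|freq K s j - dens K s| < e.
Proof.
move=> cK /(freq_lt_dens s cK)[J hJ]; exists J => j Jj.
rewrite ger0_norm ?subr_ge0 ?dens_le_freq // ltrBlDl.
exact: le_lt_trans (freq_noninc K s Jj) hJ.
Qed.

(** Additivity is read off from the recursion of [cnt] and passes to the limit, because [freq]
    converges to [dens] on compact sets. *)
Lemma dens_split K s : compact K ->
  dens K s = (dens K (rcons s false) + dens K (rcons s true)) / 2%:R.
Proof.
move=> cK; apply/eqP; rewrite -subr_eq0 -normr_eq0; apply/eqP.
apply/le_anti/andP; split; last exact: normr_ge0.
apply/ler_addgt0Pr => e e0; rewrite add0r.
have e2 : 0 < e / 2%:R by rewrite divr_gt0.
have [J1 h1] := freq_near_dens s cK e2.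
have [J2 h2] := freq_near_dens (rcons s false) cK e2.
have [J3 h3] := freq_near_dens (rcons s true) cK e2.
pose j := maxn J1 (maxn J2 J3).
have := h1 j.+1; have := h2 j; have := h3 j; rewrite freqS /j.
rewrite !leq_max !leqnn ?orbT => /(_ isT) H3 /(_ isT) H2.
rewrite leqW ?leq_maxl // => /(_ isT) H1.
move: H1 H2 H3; rewrite !ltr_norml => /andP[a1 a2] /andP[b1 b2] /andP[c1 c2].
rewrite ler_norml; apply/andP; split; lra.
Qed.

Lemma dens_le1 K s : dens K s <= 1.
Proof.
apply: le_trans (dens_le_freq K s 0) _; rewrite freq0.
by case: (met K s); rewrite /= ?ler01.
Qed.

Lemma dens_unmet K s : ~ (K `&` Nbhd s !=set0) -> dens K s = 0.
Proof.
move=> h; apply/le_anti; rewrite dens_ge0 andbT.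
by apply: le_trans (dens_le_freq K s 0) _; rewrite freq0 /met asboolF.
Qed.

Lemma Nbhd_neq0 s : Nbhd s !=set0.
Proof. by exists (nth false s); apply/NbhdP. Qed.

Lemma dens_full K s : compact K -> Nbhd s `<=` K -> dens K s = 1.
Proof.
move=> cK sK.
have fr j t : Nbhd t `<=` K -> freq K t j = 1.
  elim: j t => [|j IH] t tK.
    rewrite freq0 /met asboolT //; have [z tz] := Nbhd_neq0 t.
    by exists z; split=> //; exact: tK.
  by rewrite freqS !IH -?splitr ?mulrDl ?div1r //;
    [rewrite -[RHS]hp0 hpS /hp expr1| |] => // z /Nbhd_rcons[/tK].
apply/le_anti; rewrite dens_le1 /=; apply/ler_addgt0Pr => e e0.
have [j] := freq_lt_dens s cK e0.
by rewrite fr // => /ltW.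
Qed.

Lemma DensityP A (z : cantor_space) (r : R) :
  DensityIs A z r <->
  forall e : R, 0 < e -> exists N, forall n, (N <= n)%N -> `|dens A (restr z n) - r| < e.
Proof.
rewrite /DensityIs; split.
  move=> /cvgrPdist_lt h e /h[N _ hN]; exists N => n Nn.
  by rewrite distrC -dens_seqE; exact: hN.
move=> h; apply/cvgrPdist_lt => e /h[N hN]; exists N => // n /= Nn.
by rewrite distrC dens_seqE; exact: hN.
Qed.

End Density.

(** * Closed subsets of Baire space and analytic sets *)

Definition agree (n : nat) (x y : nat -> nat) : Prop :=
  forall i, (i < n)%N -> y i = x i.


Lemma agree_sym n x y : agree n x y -> agree n y x.
Proof. by move=> h i /h. Qed.

Lemma agree_trans n x y z : agree n x y -> agree n y z -> agree n x z.
Proof. by move=> h h' i ilt; rewrite h' // h. Qed.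

Lemma agree_le m n x y : (m <= n)%N -> agree n x y -> agree m x y.
Proof. by move=> mn h i im; apply: h; exact: leq_trans mn. Qed.

Lemma eq_mkseq_in (T : Type) n (f g : nat -> T) :
  (forall i, (i < n)%N -> f i = g i) -> mkseq f n = mkseq g n.
Proof.
elim: n => // n IH h; rewrite !mkseqS h // IH // => i ilt.
by apply: h; exact: ltnW.
Qed.

Lemma agree_mkseq n x y : agree n x y <-> mkseq y n = mkseq x n.
Proof.
split=> [h|h i ilt].
  exact: eq_mkseq_in.
by rewrite -(nth_mkseq 0%N y ilt) h nth_mkseq.
Qed.

Definition closedB (C : set (nat -> nat)) : Prop :=
  forall x, (forall n, exists2 y, C y & agree n x y) -> C x.

Section Analytic.
Variable R : realType.
Implicit Types (C : set (nat -> nat)) (h : (nat -> nat) -> R) (S : set R).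

Definition contB C h : Prop :=
  forall x, C x -> forall e : R, 0 < e ->
    exists n, forall y, C y -> agree n x y -> `|h y - h x| < e.

(** * Retraction of Baire space onto a nonempty closed subset *)

Section Retraction.
Variables (C : set (nat -> nat)) (c : nat -> nat).

Let ext (p : seq nat) : Prop := exists2 y, C y & mkseq y (size p) = p.

(** The entries of [x] are followed as long as they keep the sequence extendible to a point of [C],
    and are otherwise replaced by an admissible entry. The first [n] entries of the result depend
    only on those of [x], which gives continuity. *)
Fixpoint track (x : nat -> nat) (n : nat) : seq nat :=
  if n is n'.+1 then
    let p := track x n' in
    rcons p (if `[< ext (rcons p (x n')) >] then x n'
             else xget 0%N [set a | ext (rcons p a)])
  else [::].

Lemma size_track x n : size (track x n) = n.
Proof. by elim: n => //= n IH; rewrite size_rcons IH. Qed.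

Definition retract (x : nat -> nat) (n : nat) : nat := nth 0%N (track x n.+1) n.

Lemma mkseq_retract x n : mkseq (retract x) n = track x n.
Proof.
elim: n => //= n IH; rewrite mkseqS IH; congr rcons.
by rewrite /retract /= nth_rcons size_track ltnn eqxx.
Qed.

Hypothesis Cc : C c.

Lemma track_ext x n : ext (track x n).
Proof.
elim: n => [|n [y Cy yE]] /=; first by exists c.
case: asboolP => // _; apply: (xgetPex 0%N (P := [set a | ext (rcons _ a)])).
by exists (y n); exists y => //; rewrite size_rcons mkseqS yE size_track.
Qed.

Lemma retract_in x : closedB C -> C (retract x).
Proof.
apply=> n; have [y Cy yE] := track_ext x n; exists y => //.
by apply/agree_mkseq; rewrite mkseq_retract -yE size_track.
Qed.

Lemma retract_id x : C x -> retract x = x.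
Proof.
move=> Cx; have trE n : track x n = mkseq x n.
  elim: n => //= n IH; rewrite mkseqS -IH asboolT //.
  by exists x => //; rewrite size_rcons size_track mkseqS IH.
by apply/funext => n; rewrite /retract trE nth_mkseq.
Qed.

Lemma agree_retract n x y : agree n x y -> agree n (retract x) (retract y).
Proof.
move=> xy; apply/agree_mkseq; rewrite !mkseq_retract.
elim: n xy => //= n IH xy; rewrite IH; last by apply: agree_le xy.
by rewrite (xy n).
Qed.

End Retraction.

(** [analytic01] wants a map defined on all of Baire space; precomposing with the retraction onto
    [C] supplies it. *)
Lemma analytic_image C h : closedB C -> contB C h -> h @` C `<=` `]0, 1[ ->
  analytic01 (h @` C).
Proof.
move=> cC hC h01; split=> //.
have [->|/set0P[c Cc]] := eqVneq C set0; [by left; rewrite image_set0|right].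
exists (h \o retract C); split.
  move=> x e e0; have [n hn] := hC _ (retract_in Cc x cC) e e0.
  by exists n => y xy; apply: hn; [exact: retract_in Cc _ _|exact: agree_retract].
apply/seteqP; split=> r /= [x Cx <-].
  by exists (retract C x) => //; exact: retract_in Cc _ _.
by exists x => //=; rewrite retract_id.
Qed.

Definition cvgto (u : nat -> R) (l : R) : Prop :=
  forall e : R, 0 < e -> exists N, forall n, (N <= n)%N -> `|u n - l| < e.

Lemma cvgto_dist_le (u : nat -> R) (l a b : R) N : cvgto u l ->
  (forall n, (N <= n)%N -> `|u n - a| <= b) -> `|l - a| <= b.
Proof.
move=> ul h; apply/ler_addgt0Pr => e /ul[M hM].
have := hM (maxn N M); have := h (maxn N M).
rewrite !leq_max !leqnn orbT => /(_ isT) h1 /(_ isT) h2.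
rewrite (_ : l - a = (u (maxn N M) - a) - (u (maxn N M) - l)); last by ring.
by apply: le_trans (ler_normB _ _) _; rewrite lerD // ltW.
Qed.

Lemma cvgto_unique (u : nat -> R) (l l' : R) : cvgto u l -> cvgto u l' -> l = l'.
Proof.
move=> ul ul'; apply/eqP; rewrite -subr_eq0 -normr_eq0; apply/eqP/le_anti.
rewrite normr_ge0 andbT; apply/ler_addgt0Pr => e /ul'[N hN]; rewrite add0r.
by apply: (cvgto_dist_le (N := N) ul) => n /hN /ltW.
Qed.

Lemma cvgto_complete (u : nat -> R) :
  (forall e : R, 0 < e -> exists N, forall m n, (N <= m)%N -> (N <= n)%N ->
     `|u m - u n| <= e) -> exists l, cvgto u l.
Proof.
move=> h; have /cauchy_cvgP/cvg_ex[l /cvgrPdist_lt ul] : cauchy (u @ \oo).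
  apply/cauchy_exP => e e0; have [N hN] := h (e / 2%:R) (divr_gt0 e0 (ltr0Sn _ 1)).
  exists (u N); exists N => // n /= Nn; rewrite /ball /=.
  by apply: le_lt_trans (hN _ _ (leqnn _) Nn) _; lra.
by exists l => e /ul[N _ hN]; exists N => n Nn; rewrite distrC; exact: hN.
Qed.

(** * The values of the density as a continuous image of a closed set *)

Section UsecAnalytic.
Variables (K : set cantor_space) (s : seq bool).

(** The restriction to [Nbhd s] serves the Borel case, where the sets of incompatible strings are
    separated; the empty string gives all of [Usec]. *)
Definition Ulocal : set R :=
  [set r | 0 < r < 1 /\ exists2 z, Nbhd s z & DensityIs K z r].

(* A code lists a margin [x 0] keeping the density off 0 and 1, the bits of [z], and a
   modulus of convergence. *)
Let zof (x : nat -> nat) : cantor_space := fun i => odd (x i.*2.+1).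
Let Nof (x : nat -> nat) k : nat := x k.*2.+2.
Let d (x : nat -> nat) n : R := dens R K (restr (zof x) n).

Let codes : set (nat -> nat) := [set x | [/\ Nbhd s (zof x),
  forall k m n, (Nof x k <= m)%N -> (Nof x k <= n)%N -> `|d x m - d x n| <= hp R k
  & forall n, (x 0%N <= n)%N -> hp R (x 0%N) <= d x n <= 1 - hp R (x 0%N)]].

Let d_agree n x y : agree n.*2 x y -> restr (zof y) n = restr (zof x) n.
Proof.
move=> xy; apply: eq_mkseq_in => i ilt.
by rewrite /zof xy //; lia.
Qed.

(** For fixed [k], [m], [n] each condition reads finitely many values of [x], so it passes from
    codes agreeing with [x] far enough to [x] itself. *)
Let closed_codes : closedB codes.
Proof.
move=> x hx; split.
- have [y [sy _ _] xy] := hx (size s).*2.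
  by move: sy; rewrite /Nbhd /= (d_agree xy).
- move=> k m n; have [y [_ hy _] xy] := hx (m.*2 + n.*2 + k.*2 + 3)%N.
  have := hy k m n; rewrite /Nof /d (xy k.*2.+2) ?(d_agree (agree_le _ xy)) //; lia.
- move=> n; have [y [_ _ hy] xy] := hx n.*2.+1.
  have := hy n; rewrite /d (xy 0%N) // (d_agree (agree_le _ xy)) //; lia.
Qed.

Let val (x : nat -> nat) : R := xget 0 [set l | cvgto (d x) l].

Let valP x : codes x -> cvgto (d x) (val x).
Proof.
move=> [_ h _]; apply: (xgetPex 0 (P := [set l | cvgto (d x) l])).
apply: cvgto_complete => e /hp_arch[k ke]; exists (Nof x k) => m n hm hn.
exact: le_trans (h _ _ _ hm hn) (ltW ke).
Qed.

(** The agreeing values fix the modulus at [k] and the node at that depth, whose density is within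
    [hp k] of both limits. *)
Let cont_val : contB codes val.
Proof.
move=> x xC e e0; have [k ke] := hp_arch (divr_gt0 e0 (ltr0Sn R 1)).
exists ((Nof x k).*2 + k.*2.+3)%N => y yC xy.
have NE : Nof y k = Nof x k by rewrite /Nof xy //; lia.
have dE : d y (Nof x k) = d x (Nof x k).
  by rewrite /d (d_agree (agree_le _ xy)) //; lia.
have near w : codes w -> `|val w - d w (Nof w k)| <= hp R k.
  move=> wC; apply: (cvgto_dist_le (N := Nof w k) (valP wC)) => n hn.
  by case: wC => _ + _; apply.
have := near _ xC; have := near _ yC; rewrite NE dE => h1 h2.
rewrite (_ : val y - val x = (val y - d x (Nof x k)) - (val x - d x (Nof x k))); last by ring.
by apply: le_lt_trans (ler_normB _ _) _; lra.
Qed.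

Lemma Ulocal_analytic : analytic01 Ulocal.
Proof.
suff -> : Ulocal = val @` codes.
  apply: analytic_image => // _ [x xC <-]; have [_ _ h] := xC.
  rewrite /= in_itv /=; have := valP xC => vx.
  have p0 : 0 < hp R (x 0%N) by exact: hp_gt0.
  have : `|val x - 1 / 2%:R| <= 1 / 2%:R - hp R (x 0%N).
    apply: (cvgto_dist_le (N := x 0%N) vx) => n /h /andP[h1 h2].
    by rewrite ler_norml; apply/andP; split; lra.
  by rewrite ler_norml => /andP[h1 h2]; apply/andP; split; lra.
apply/seteqP; split=> r.
  move=> [/andP[r0 r1] [z sz /DensityP rz]].
  have [N hN] : exists N : nat -> nat, forall k n, (N k <= n)%N ->
      `|dens R K (restr z n) - r| < hp R k.+1.
    have rz' k := rz _ (hp_gt0 R k.+1).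
    by have [N hN] := choice rz'; exists N.
  have [p hp'] : exists p, forall n, (p <= n)%N ->
      hp R p <= dens R K (restr z n) <= 1 - hp R p.
    (* Densities within [e] of [r] keep the distance [e] from 0 and 1 when [r] keeps twice that
       distance. *)
    have [e [e0 e1 e2]] : exists e : R, [/\ 0 < e, 2%:R * e <= r & 2%:R * e <= 1 - r].
      case: (leP r (1 - r)) => h; [exists (r / 2%:R)|exists ((1 - r) / 2%:R)]; split; lra.
    have [M hM] := rz _ e0; have [q hq] := hp_arch e0.
    exists (maxn M q) => n; rewrite geq_max => /andP[/hM + qn].
    have := @hp_le R _ _ (leq_maxr M q).
    by rewrite ltr_norml => h1 /andP[h2 h3]; apply/andP; split; lra.
  pose x (i : nat) : nat := if i is i'.+1 then
    (if odd i then nat_of_bool (z i'./2) else N i'./2) else p.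
  have zE : zof x = z.
    by apply/funext => i; rewrite /zof /= odd_double /= doubleK; case: (z i).
  have NE k : Nof x k = N k by rewrite /Nof /= odd_double /= uphalf_double.
  have xC : codes x.
    split; rewrite ?zE // /d zE ?NE // => k m n; rewrite NE => /hN h1 /hN h2.
    rewrite (_ : dens _ _ _ - _ = (dens R K (restr z m) - r) - (dens R K (restr z n) - r));
      last by ring.
    by rewrite (hpS R k); apply: le_trans (ler_normB _ _) _; rewrite lerD // ltW.
  exists x => //; apply: cvgto_unique (valP xC) _.
  by move=> e /rz; rewrite /d zE.
move=> [x xC <-]; have vx := valP xC; have [sx _ h] := xC; split; last first.
  by exists (zof x) => //; apply/DensityP.
have p0 : 0 < hp R (x 0%N) by exact: hp_gt0.
have : `|val x - 1 / 2%:R| <= 1 / 2%:R - hp R (x 0%N).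
  apply: (cvgto_dist_le (N := x 0%N) vx) => n /h /andP[h1 h2].
  by rewrite ler_norml; apply/andP; split; lra.
by rewrite ler_norml => /andP[h1 h2]; apply/andP; split; lra.
Qed.

End UsecAnalytic.

Lemma Usec_analytic (K : set cantor_space) : analytic01 (@Usec R K).
Proof.
rewrite (_ : Usec _ = Ulocal K [::]); first exact: Ulocal_analytic.
apply/seteqP; split=> r [r01 [z hz]]; split=> //; first by exists z.
by exists z.
Qed.

Lemma UcsecE (K : set cantor_space) : @Ucsec R K = `]0, 1[ `\` @Usec R K.
Proof. by apply/seteqP; split=> r /=; rewrite in_itv. Qed.

Lemma Ucsec_coanalytic (K : set cantor_space) : coanalytic01 (@Ucsec R K).
Proof.
rewrite UcsecE; split; first exact: subDsetl.
rewrite setDD setIidr; first exact: Usec_analytic.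
by move=> r [r01 _] /=; rewrite in_itv.
Qed.

End Analytic.

(** * Separation, and Borel sections *)

Section Borel.
Variable R : realType.
Implicit Types A B S : set R.

Definition borel (A : set R) : Prop := <<s (@open R) >> A.

Let sigma : sigma_algebra setT borel := smallest_sigma_algebra setT (@open R).

Lemma borel_open A : open A -> borel A.
Proof. by move=> oA; apply: sub_sigma_algebra. Qed.

Lemma borelC A : borel A -> borel (~` A).
Proof. by case: sigma => _ h _ /h; rewrite setTD. Qed.

Lemma borel_bigcup (F : nat -> set R) : (forall i, borel (F i)) -> borel (\bigcup_i F i).
Proof. by case: sigma => _ _; apply. Qed.

Lemma borel_bigcap (F : nat -> set R) : (forall i, borel (F i)) -> borel (\bigcap_i F i).
Proof.
move=> h; rewrite -(setCK (bigcap _ _)) setC_bigcap; apply: borelC; apply: borel_bigcup => i.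
exact: borelC.
Qed.

Lemma borel0 : borel set0. Proof. by apply: borel_open; exact: open0. Qed.

Lemma borelT : borel setT. Proof. by apply: borel_open; exact: openT. Qed.

Lemma borel_bigcup_count (T : countType) (F : T -> set R) :
  (forall t, borel (F t)) -> borel (\bigcup_t F t).
Proof.
move=> h; rewrite (_ : bigcup _ _ = \bigcup_i (if unpickle i is Some t then F t else set0)).
  by apply: borel_bigcup => i; case: unpickle => [t|]; [exact: h|exact: borel0].
apply/seteqP; split=> r [t _ tr]; first by exists (pickle t) => //; rewrite pickleK.
by case: unpickle tr => // u ur; exists u.
Qed.

Lemma borel_bigcap_count (T : countType) (F : T -> set R) :
  (forall t, borel (F t)) -> borel (\bigcap_t F t).
Proof.
move=> h; rewrite -(setCK (bigcap _ _)) setC_bigcap.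
by apply: borelC; apply: borel_bigcup_count => i; exact: borelC.
Qed.

Lemma borelI A B : borel A -> borel B -> borel (A `&` B).
Proof.
move=> hA hB; rewrite (_ : A `&` B = \bigcap_i (if i is 0%N then A else B)).
  by apply: borel_bigcap => -[|i].
apply/seteqP; split=> r; first by move=> [Ar Br] [|i].
by move=> h; split; [exact: (h 0%N)|exact: (h 1%N)].
Qed.

Lemma borelD A B : borel A -> borel B -> borel (A `\` B).
Proof. by move=> hA hB; rewrite setDE; apply: borelI => //; exact: borelC. Qed.

Lemma borel_if (P : Prop) A : (P -> borel A) -> borel [set r | P /\ A r].
Proof.
move=> h; have [p|np] := pselect P.
  by rewrite (_ : mkset _ = A); [exact: h|apply/seteqP; split=> r /=; tauto].
rewrite (_ : mkset _ = set0); first exact: borel0.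
by apply/seteqP; split=> r //= [].
Qed.

Lemma borel_imp (P : Prop) A : (P -> borel A) -> borel [set r | P -> A r].
Proof.
move=> h; have [p|np] := pselect P.
  rewrite (_ : mkset _ = A); first exact: h.
  by apply/seteqP; split=> r /=; tauto.
rewrite (_ : mkset _ = setT); first exact: borelT.
by apply/seteqP; split=> r //=.
Qed.

Definition separated A B : Prop := exists S, [/\ borel S, A `<=` S & B `<=` ~` S].

Lemma separated_bigcup (F G : nat -> set R) :
  (forall i j, separated (F i) (G j)) -> separated (\bigcup_i F i) (\bigcup_j G j).
Proof.
move=> h.
have [S hS] : exists S : nat -> nat -> set R, forall i j,
    [/\ borel (S i j), F i `<=` S i j & G j `<=` ~` S i j].
  have [S hS] := choice (fun ij : nat * nat => h ij.1 ij.2).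
  by exists (fun i j => S (i, j)) => i j; exact: (hS (i, j)).
exists (\bigcup_i \bigcap_j S i j); split.
- by apply: borel_bigcup => i; apply: borel_bigcap => j; case: (hS i j).
- by move=> r [i _ ir]; exists i => // j _; case: (hS i j) => _ h1 _; exact: h1.
- move=> r [j _ jr] [i _ /(_ j I) ir]; case: (hS i j) => _ _ h2; exact: h2 ir.
Qed.

Let cyl (s : seq nat) : set (nat -> nat) := [set x | mkseq x (size s) = s].

Let cylS (f : (nat -> nat) -> R) s : f @` cyl s = \bigcup_a f @` cyl (rcons s a).
Proof.
apply/seteqP; split=> r.
  move=> [x xs <-]; exists (x (size s)) => //; exists x => //.
  by rewrite /cyl /= size_rcons mkseqS xs.
move=> [a _ [x + <-]]; rewrite /cyl /= size_rcons mkseqS => /eqP.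
by rewrite eqseq_rcons => /andP[/eqP xs _]; exists x.
Qed.

(* An inseparable pair of images yields two branches all of whose neighbourhoods have
   inseparable images, contradicting continuity. *)
Lemma lusin_separation (f g : (nat -> nat) -> R) :
  baire_continuous f -> baire_continuous g ->
  (forall x y, f x <> g y) -> separated (range f) (range g).
Proof.
move=> cf cg fg; apply: contrapT => nsep.
pose bad (p : seq nat * seq nat) := ~ separated (f @` cyl p.1) (g @` cyl p.2).
have step (p : {p | bad p}) : exists ab : nat * nat,
    bad (rcons (sval p).1 ab.1, rcons (sval p).2 ab.2).
  apply: contrapT => /forallNP h; apply: (svalP p).
  rewrite !cylS; apply: separated_bigcup => a b.
  by apply: contrapT => nab; exact: (h (a, b) nab).
have [F hF] := choice step.
have bad0 : bad ([::], [::]).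
  rewrite /bad /= (_ : cyl [::] = setT) //.
  by apply/seteqP; split=> x.
pose st := fix st n : {p | bad p} := if n is n'.+1 then exist _ _ (hF (st n'))
  else exist _ _ bad0.
pose x n := (F (st n)).1; pose y n := (F (st n)).2.
have stE n : sval (st n) = (mkseq x n, mkseq y n).
  by elim: n => // n IH; rewrite !mkseqS /= IH.
have /eqP := fg x y; rewrite -subr_eq0 -normr_gt0 => d0.
have d2 := divr_gt0 d0 (ltr0Sn R 1).
have [n hn] := cf x _ d2; have [m hm] := cg y _ d2.
pose k := maxn n m; apply: (svalP (st k)); rewrite stE /=.
(* The radius is half the distance of the two limits, and at stage [k] both images stay closer than
   that to their own limit: the ball separates the pair. *)
exists (ball (f x) (`|f x - g y| / 2%:R)); split.
- by apply: borel_open; exact: ball_open.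
- move=> _ [x' x'k <-]; rewrite /ball /= distrC; apply: hn => i ilt.
  have ik : (i < k)%N by rewrite (leq_trans ilt) // leq_maxl.
  by move: x'k; rewrite /cyl /= size_mkseq => /(congr1 (nth 0%N ^~ i)); rewrite !nth_mkseq.
- move=> _ [y' y'k <-]; rewrite /ball /= => fy.
  have : `|g y' - g y| < `|f x - g y| / 2%:R.
    apply: hm => i ilt.
    have ik : (i < k)%N by rewrite (leq_trans ilt) // leq_maxr.
    by move: y'k; rewrite /cyl /= size_mkseq => /(congr1 (nth 0%N ^~ i)); rewrite !nth_mkseq.
  have := ler_distD (g y') (f x) (g y).
  by move: fy; move: (`|f x - g y|) (`|f x - g y'|) (`|g y' - g y|) => a b c; lra.
Qed.

Lemma analytic_separation A B : analytic01 A -> analytic01 B -> A `&` B = set0 ->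
  separated A B.
Proof.
move=> [_ [->|[f [cf <-]]]] [_ hB] AB.
  exists set0; split; [exact: borel0|by []|by move=> r _ []].
case: hB AB => [->|[g [cg <-]]] AB.
  by exists setT; split; [exact: borelT| |].
apply: lusin_separation => // x y fxy.
suff : (set0 : set R) (f x) by [].
by rewrite -AB; split; [exists x | exists y].
Qed.

(** * Borel sections when no value of (0;1) is taken twice *)

Section RngInj.
Variable K : set cantor_space.
Hypothesis Kinj : Rng_inj R K.

Let compat (s t : seq bool) := prefix s t || prefix t s.

Let restr_prefix (z : cantor_space) m n : (m <= n)%N -> prefix (restr z m) (restr z n).
Proof.
move=> mn; rewrite prefixE size_mkseq /restr /mkseq -map_take take_iota.
by rewrite (minn_idPl mn).
Qed.

Let compat_nth s t i : compat s t -> (i < size s)%N -> (i < size t)%N ->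
  nth false s i = nth false t i.
Proof. by case/orP => /prefixP[u ->] h1 h2; rewrite nth_cat ?h1 ?h2. Qed.

Let compat_size s t : compat s t -> size s = size t -> s = t.
Proof.
move=> st sz; apply: (eq_from_nth (x0 := false)) => // i ilt.
by apply: compat_nth => //; rewrite -sz.
Qed.

Let Ulocal_disjoint s t : ~~ compat s t -> @Ulocal R K s `&` @Ulocal R K t = set0.
Proof.
move=> st; apply/seteqP; split=> // r [[r01 [z sz dz]] [_ [z' tz' dz']]].
move: st; rewrite (Kinj dz dz' r01) in sz; rewrite -sz -tz' /compat.
by case/orP: (leq_total (size s) (size t)) => h; rewrite (restr_prefix z' h) ?orbT.
Qed.

(** Injectivity makes the sets [Ulocal] of incompatible strings disjoint, hence separable by Borel
    sets. There are countably many strings, so all separations involving [s] can be intersected into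
    one Borel set. *)
Let blocks_exist : exists B : seq bool -> set R, forall s,
  [/\ borel (B s), @Ulocal R K s `<=` B s & forall t r, B s r -> B t r -> compat s t].
Proof.
have sep (p : seq bool * seq bool) : exists S, ~~ compat p.1 p.2 ->
    [/\ borel S, @Ulocal R K p.1 `<=` S & @Ulocal R K p.2 `<=` ~` S].
  have [c|c] := boolP (compat p.1 p.2); first by exists set0.
  have [S hS] := analytic_separation (@Ulocal_analytic R K p.1)
    (@Ulocal_analytic R K p.2) (Ulocal_disjoint c).
  by exists S.
have [S hS] := choice sep.
(* [S (s, t)] and [S (t, s)] are chosen independently; the difference makes [D s t] and [D t s]
   disjoint. *)
pose D s t := S (s, t) `\` S (t, s).
have compatC s t : compat s t = compat t s by rewrite /compat orbC.
exists (fun s => \bigcap_t [set r | ~~ compat s t -> D s t r]) => s; split.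
- apply: borel_bigcap_count => t; apply: borel_imp => st.
  have [b1 _ _] := hS (s, t) st; rewrite compatC in st.
  by have [b2 _ _] := hS (t, s) st; apply: borelD.
- move=> r sr t _ /= st; have [_ + _] := hS (s, t) st => /(_ _ sr) h1.
  by rewrite compatC in st; have [_ _ /(_ _ sr)] := hS (t, s) st.
- move=> t r hs ht; apply/negPn/negP => st.
  have [_] := hs t I st; rewrite compatC in st.
  by have [] := ht s I st.
Qed.

Lemma Usec_borel : borel01 (@Usec R K).
Proof.
split; first by move=> r [r01 _] /=; rewrite in_itv.
have [B hB] := blocks_exist.
pose near k s : set R := [set r | `|dens R K s - r| < hp R k].
(* The quantifier over points becomes one over the countably many nodes of each level. Strings whose
   blocks contain the same [r] are compatible, so from some level on they trace a single point, and
   the densities along it tend to [r]. *)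
suff -> : Usec K = `]0, 1[ `&` \bigcap_k \bigcup_N \bigcap_n
    [set r | (N <= n)%N -> (\bigcup_s [set r | size s = n /\ (B s `&` near k s) r]) r].
  apply: borelI; first by apply: borel_open; exact: interval_open.
  apply: borel_bigcap => k; apply: borel_bigcup => N; apply: borel_bigcap => n.
  apply: borel_imp => _; apply: borel_bigcup_count => s; apply: borel_if => _.
  apply: borelI; first by case: (hB s).
  apply: borel_open; rewrite (_ : near k s = ball (dens R K s) (hp R k)) //.
  by apply: ball_open; exact: hp_gt0.
apply/seteqP; split=> r.
  move=> [r01 [z dz]]; split; first by rewrite /= in_itv.
  move=> k _; have /DensityP/(_ _ (hp_gt0 R k))[N hN] := dz; exists N => // n _ Nn.
  exists (restr z n) => //; split; first by rewrite size_mkseq.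
  split; last exact: hN.
  have [_ + _] := hB (restr z n); apply; split=> //.
  by exists z => //; exact: Nbhd_restr.
move=> [/= + h]; rewrite in_itv /= => r01; split=> //.
have [N0 _ h0] := h 0%N I.
have [sg hsg] : exists sg : nat -> seq bool, forall n, (N0 <= n)%N ->
    size (sg n) = n /\ B (sg n) r.
  have ex n : exists s, (N0 <= n)%N -> size s = n /\ B s r.
    have [Nn|_] := leqP N0 n; last by exists [::].
    by have [s _ [sn [sB _]]] := h0 n I Nn; exists s.
  by have [sg hsg] := choice ex; exists sg.
(* Bit [i] is taken from a chosen string that is longer than [i] and has length at least [N0]; by
   compatibility every such string has the same bit there. *)
pose z : cantor_space := fun i => nth false (sg (N0 + i.+1)%N) i.
have zsg n : (N0 <= n)%N -> restr z n = sg n.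
  move=> Nn; have [sn Bn] := hsg n Nn.
  apply: (eq_from_nth (x0 := false)); rewrite size_mkseq // => i ilt.
  rewrite nth_mkseq // /z; have [sm Bm] := hsg _ (leq_addr i.+1 N0).
  have [_ _ /(_ _ _ Bm Bn) c] := hB (sg (N0 + i.+1)%N).
  by apply: compat_nth => //; rewrite ?sm ?sn //; lia.
exists z; apply/DensityP => e /hp_arch[k ke].
have [N _ hN] := h k I; exists (maxn N N0) => n.
rewrite geq_max => /andP[Nn N0n]; have [s _ [sn [sB sr]]] := hN n I Nn.
rewrite zsg //; have [sn' Bn] := hsg n N0n.
have [_ _ /(_ _ _ sB Bn) c] := hB s.
by rewrite -(compat_size c) ?sn ?sn' //; exact: lt_trans ke.
Qed.

End RngInj.

Lemma Ucsec_borel (K : set cantor_space) : Rng_inj R K -> borel01 (@Ucsec R K).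
Proof.
move=> /Usec_borel[_ h]; rewrite UcsecE; split; first exact: subDsetl.
by apply: borelD => //; apply: borel_open; exact: interval_open.
Qed.

End Borel.

(** * Realizing a limit of node values as densities *)

Definition dup (y : cantor_space) : cantor_space := fun i => y i./2.

Definition dbl (s : seq bool) : seq bool :=
  mkseq (fun i => nth false s i./2) (size s).*2.

Definition bitval (t : seq bool) : nat := foldl (fun a (b : bool) => a.*2 + b)%N 0%N t.

Lemma bitval_rcons t b : bitval (rcons t b) = ((bitval t).*2 + b)%N.
Proof. by rewrite /bitval foldl_rcons. Qed.

Lemma size_dbl s : size (dbl s) = (size s).*2. Proof. by rewrite size_mkseq. Qed.

Lemma dbl_rcons s b : dbl (rcons s b) = rcons (rcons (dbl s) b) b.
Proof.
rewrite /dbl size_rcons doubleS !mkseqS /= uphalf_double doubleK !nth_rcons ltnn eqxx.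
congr (rcons (rcons _ _) _); apply: eq_mkseq_in => i ilt.
by rewrite nth_rcons (_ : (i./2 < size s)%N) //; lia.
Qed.

Lemma restr_dup y n : restr (dup y) n.*2 = dbl (restr y n).
Proof.
rewrite /dbl size_mkseq; apply: eq_mkseq_in => i ilt.
by rewrite nth_mkseq //; lia.
Qed.

Section Realize.
Variable R : realType.
Variables (tau : seq bool -> R) (g : cantor_space -> R).
Hypothesis tau01 : forall s, 0 <= tau s <= 1.
Hypothesis tau_cvg : forall y : cantor_space, cvgto (fun n => tau (restr y n)) (g y).

(* Averaging along the branch keeps the limits and makes the values vary slowly; rounding
   makes them measures of clopen sets. *)
Definition mean (s : seq bool) : R :=
  (\sum_(i < (size s).+1) tau (take i s)) / (size s).+1%:R.

Definition num (s : seq bool) : nat := Num.truncn (mean s * 2%:R ^+ size s).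

Definition theta (s : seq bool) : R := (num s)%:R * hp R (size s).

Lemma mean01 s : 0 <= mean s <= 1.
Proof.
rewrite /mean ler_pdivrMr // mul1r divr_ge0 ?sumr_ge0 //=; last first.
  by move=> i _; case/andP: (tau01 (take i s)).
apply: le_trans (_ : \sum_(i < (size s).+1) (1 : R) <= _).
  by apply: ler_sum => i _; case/andP: (tau01 (take i s)).
by rewrite sumr_const card_ord.
Qed.

Lemma theta_mean s : theta s <= mean s < theta s + hp R (size s).
Proof.
have p0 : 0 < (2%:R : R) ^+ size s by rewrite exprn_gt0.
have /andP[m0 _] := mean01 s.
have := truncn_itv (mulr_ge0 m0 (ltW p0)); rewrite -/(num s) /theta /hp => /andP[h1 h2].
rewrite ler_pdivrMr // h1 /= -[X in _ + X]mul1r -mulrDl ltr_pdivlMr //.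
by rewrite natr1.
Qed.

Lemma num_le s : (num s <= 2 ^ size s)%N.
Proof.
have /andP[_ m1] := mean01 s; have /andP[h _] := theta_mean s.
have := le_trans h m1; rewrite /theta /hp ler_pdivrMr ?exprn_gt0 // mul1r.
by rewrite -natrX ler_nat.
Qed.

Lemma theta01 s : 0 <= theta s <= 1.
Proof.
rewrite /theta mulr_ge0 ?hp_ge0 //=; have /andP[h _] := theta_mean s.
by apply: le_trans h _; case/andP: (mean01 s).
Qed.

(** Two shares of [1/(n+1)]: one bounds the change of [mean] from level [n] to the next, the other
    the rounding error of [theta]. *)
Definition eps (n : nat) : R := 2%:R / n.+1%:R.

Lemma eps_cvg (e : R) : 0 < e -> exists N, forall n, (N <= n)%N -> eps n < e.
Proof.
move=> e0; have e2 := divr_gt0 e0 (ltr0Sn R 1).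
have [N _ hN] := near_infty_natSinv_lt (PosNum e2).
by exists N => n /hN /=; rewrite /eps (mulrC 2%:R) -ltr_pdivlMr.
Qed.

Lemma eps_le m n : (m <= n)%N -> eps n <= eps m.
Proof. by move=> mn; rewrite /eps ler_pM2l // lef_pV2 ?posrE // ler_nat. Qed.

Lemma hp_le_inv n : hp R n <= n.+1%:R^-1.
Proof.
by rewrite /hp lef_pV2 ?posrE ?exprn_gt0 // -natrX ler_nat ltn_expl.
Qed.

Lemma mean_rcons s b :
  mean (rcons s b) = ((size s).+1%:R * mean s + tau (rcons s b)) / (size s).+2%:R.
Proof.
rewrite /mean size_rcons big_ord_recr /= (@take_oversize _ (size s).+1) ?size_rcons //.
congr (_ / _); congr (_ + _); rewrite mulrC divfK ?pnatr_eq0 //.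
apply: eq_bigr => i _; congr tau; rewrite -cats1 takel_cat //.
by rewrite -ltnS ltn_ord.
Qed.

Lemma theta_rcons s b : `|theta (rcons s b) - theta s| <= eps (size s).
Proof.
have /andP[a1 a2] := theta_mean s; have /andP[b1 b2] := theta_mean (rcons s b).
have h1 := hp_le_inv (size s); have h2 := hp_le_inv (size s).+1.
have m1 := mean_rcons s b.
have /andP[c1 c2] := mean01 s; have /andP[d1 d2] := tau01 (rcons s b).
rewrite size_rcons in b2.
set n := (size s) in h1 h2 m1 a2 b2 *.
have diff : `|mean (rcons s b) - mean s| <= n.+2%:R^-1.
  have -> : mean (rcons s b) - mean s = (tau (rcons s b) - mean s) / n.+2%:R.
    have nz : (n.+2%:R : R) != 0 by rewrite pnatr_eq0.
    apply: (mulIf nz); rewrite mulrBl m1 !divfK // -[in n.+2%:R]natr1.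
    by ring.
  rewrite normrM [`|_^-1|]ger0_norm ?invr_ge0 // ler_piMl ?invr_ge0 //.
  by rewrite ler_norml; apply/andP; split; lra.
have i1 : (n.+2%:R^-1 : R) <= n.+1%:R^-1 by rewrite lef_pV2 ?posrE // ler_nat.
have -> : eps n = n.+1%:R^-1 + n.+1%:R^-1 by rewrite /eps mulrDl mul1r.
move: i1 h1 h2 diff {m1}; move: (n.+1%:R^-1) (n.+2%:R^-1) => u v i1 h1 h2.
by rewrite !ler_norml => /andP[e1 e2]; apply/andP; split; lra.
Qed.

Lemma theta_cvg (y : cantor_space) : cvgto (fun n => theta (restr y n)) (g y).
Proof.
have mE n : mean (restr y n) = arithmetic_mean (fun n => tau (restr y n)) n.
  rewrite /mean /arithmetic_mean size_mkseq mulrC; congr (_ * _).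
  rewrite seriesEord; apply: eq_bigr => i _; congr tau.
  by rewrite /restr /mkseq -map_take take_iota (minn_idPl _) // -ltnS ltn_ord.
have : arithmetic_mean (fun n => tau (restr y n)) @ \oo --> g y.
  apply: cesaro; apply/cvgrPdist_lt => e /(tau_cvg y)[N hN].
  by exists N => // n /= Nn; rewrite distrC; exact: hN.
move=> /cvgrPdist_lt h e e0; have e2 := divr_gt0 e0 (ltr0Sn R 1).
have [N _ hN] := h _ e2; have [k hk] := hp_arch e2.
exists (maxn N k) => n; rewrite geq_max => /andP[Nn kn].
have := hN n Nn; rewrite -mE; have := theta_mean (restr y n); rewrite size_mkseq.
have := hp_le R kn; rewrite !ltr_norml => a /andP[b c] /andP[d f].
by apply/andP; split; lra.
Qed.

Let mism (z : cantor_space) n : Prop :=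
  (forall i, (i < n)%N -> z i.*2 = z i.*2.+1) /\ z n.*2 <> z n.*2.+1.

Let small (z : cantor_space) n : bool :=
  (bitval (mkseq (fun i => z (n.*2 + i.+2)%N) n) < num (mkseq (fun i => z i.*2) n))%N.

(* A point leaving the diagonal after reading the doubled [s] is in the set iff its next
   [size s] bits code a number below [num s]. *)
Definition target : set cantor_space := [set z | forall n, mism z n -> small z n].

Let K := target.

Let mism_uniq z m n : mism z m -> mism z n -> m = n.
Proof.
move=> [a b] [c d]; apply/eqP; rewrite eqn_leq; apply/andP; split; rewrite leqNgt; apply/negP.
  by move=> /a.
by move=> /c.
Qed.

Let KE z n : mism z n -> (K z <-> small z n).
Proof.
move=> zn; split=> [|h m zm]; first exact.
by rewrite (mism_uniq zm zn).
Qed.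

(** Both conditions read only the first [2n] bits, the unequal pair, and the [n] bits behind it.
    Therefore [target] is closed, and its density off the diagonal is 0 or 1. *)
Let mism_Nbhd z n (y : cantor_space) m : (n.*2 + n + 2 <= m)%N ->
  mism z n -> Nbhd (restr z m) y -> mism y n /\ small y n = small z n.
Proof.
move=> nm [a b] /Nbhd_restrP yz; split.
  have yE i : (i <= n.*2.+1)%N -> y i = z i by move=> h; apply: yz; lia.
  by split=> [i ilt|]; [rewrite yE ?(yE i.*2.+1) ?a //; lia|rewrite !yE].
rewrite /small; congr (bitval _ < num _)%N; apply: eq_mkseq_in => i ilt; rewrite yz //; lia.
Qed.

Lemma compact_target : compact target.
Proof.
apply: subclosed_compact cantor_space_compact _ => //.
rewrite -openC (_ : ~` _ = \bigcup_(s in [set s | Nbhd s `<=` ~` K]) Nbhd s).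
  by apply: bigcup_open => s _; exact: open_Nbhd.
apply/seteqP; split=> z; last by move=> [s sK sz]; exact: sK.
move=> /existsNP[n /not_implyP[zn nsm]].
exists (restr z (n.*2 + n + 2)); last exact: Nbhd_restr.
move=> y yz; have [yn sE] := mism_Nbhd (leqnn _) zn yz.
by move=> /(KE yn); rewrite sE.
Qed.

Let cK : compact K := compact_target.

Let fork s b := rcons (rcons (dbl s) b) (~~ b).

Let Nbhd_fork s b t z : size t = size s -> Nbhd (fork s b ++ t) z ->
  mism z (size s) /\ small z (size s) = (bitval t < num s)%N.
Proof.
have -> : fork s b ++ t = dbl s ++ [:: b, ~~ b & t] by rewrite /fork -!cats1 -!catA.
move=> st /NbhdP; rewrite size_cat /= size_dbl st => h.
have h0 i : (i < (size s).*2)%N -> z i = nth false s i./2.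
  move=> ilt; rewrite h; last by lia.
  by rewrite nth_cat size_dbl ilt /dbl nth_mkseq.
have h1 : z (size s).*2 = b.
  rewrite h; last by lia.
  by rewrite nth_cat size_dbl ltnn subnn.
have h2 : z (size s).*2.+1 = ~~ b.
  rewrite h; last by lia.
  by rewrite nth_cat size_dbl ltnNge leqnSn /= subSnn.
split.
  split=> [i ilt|]; last by rewrite h1 h2; case: b {h1 h2 h}.
  by rewrite !h0 /=; try lia; rewrite uphalf_double doubleK.
rewrite /small; congr (bitval _ < num _)%N.
  apply: (eq_from_nth (x0 := false)); rewrite size_mkseq // => i ilt.
  rewrite nth_mkseq // h; last by lia.
  rewrite nth_cat size_dbl (_ : (_ < _)%N = false); last by lia.
  by rewrite (_ : (_ - _)%N = i.+2) //; lia.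
apply: (eq_from_nth (x0 := false)); rewrite size_mkseq // => i ilt.
by rewrite nth_mkseq // h0 ?doubleK //; lia.
Qed.

(** The [2^j] completions of [t] carry the consecutive codes starting at [bitval t * 2^j]; the
    minimum counts those below [num s]. *)
Let dens_fork_cat s b j t : (size t + j)%N = size s ->
  dens R K (fork s b ++ t) =
  (minn (2 ^ j) (num s - bitval t * 2 ^ j))%:R * hp R j.
Proof.
elim: j t => [|j IH] t.
  rewrite addn0 expn0 muln1 hp0 mulr1 => st.
  have [lt|ge] := ltnP (bitval t) (num s).
    rewrite dens_full //; first by rewrite (_ : minn _ _ = 1%N) //; lia.
    by move=> z /(Nbhd_fork st)[zm sm]; apply/(KE zm); rewrite sm.
  rewrite dens_unmet; first by rewrite (_ : minn _ _ = 0%N) //; lia.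
  move=> [z [Kz /(Nbhd_fork st)[zm sm]]].
  by move/(KE zm): Kz; rewrite sm ltnNge ge.
move=> st; rewrite (dens_split R _ cK) !rcons_cat !IH ?size_rcons //; try lia.
rewrite !bitval_rcons addn0 -mulrDl -natrD (hpS R j) -mulrA; congr (_%:R * _).
  by rewrite !mulnDl !expnS -doubleMl -muln2 mul1n; lia.
by rewrite mulrDl -splitr.
Qed.

Let dens_fork s b : dens R K (fork s b) = theta s.
Proof.
have := @dens_fork_cat s b (size s) [::] erefl; rewrite cats0 => ->.
by rewrite /bitval /= mul0n subn0 (minn_idPr (num_le s)).
Qed.

Let dens_half s b :
  dens R K (rcons (dbl s) b) = (dens R K (dbl (rcons s b)) + theta s) / 2%:R.
Proof.
rewrite (dens_split R _ cK) dbl_rcons; congr (_ / _).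
by case: b (dens_fork s b); rewrite /fork /= => -> //; rewrite addrC.
Qed.

(** Two bits below [dbl s], half of the measure lies in the forks, of density exactly [theta s], and
    half in the two next doubled nodes. The error at [s] is thus at most half of the sum of an error
    at the next level and the change of [theta], and [(hp m + 2 eps) / 2] is again of the form
    [hp m.+1 + eps]. The trivial bound 1 starts the induction. *)
Let dens_dbl_near m s : `|dens R K (dbl s) - theta s| <= hp R m + eps (size s).
Proof.
elim: m s => [|m IH] s.
  rewrite hp0; have /andP[a b] := theta01 s.
  have c := dens_ge0 R K (dbl s); have d := dens_le1 R K (dbl s).
  have e : 0 <= eps (size s) by rewrite divr_ge0.
  by rewrite ler_norml; apply/andP; split; lra.
rewrite (dens_split R _ cK) !dens_half.
have := IH (rcons s false); have := IH (rcons s true); rewrite !size_rcons.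
have := theta_rcons s false; have := theta_rcons s true.
have := eps_le (leqnSn (size s)); have := hpS R m.
rewrite !ler_norml => a b /andP[c1 c2] /andP[d1 d2] /andP[e1 e2] /andP[f1 f2].
by apply/andP; split; lra.
Qed.

Let dens_dbl s : `|dens R K (dbl s) - theta s| <= eps (size s).
Proof.
apply/ler_addgt0Pr => e /hp_arch[m me].
by apply: le_trans (dens_dbl_near m s) _; rewrite addrC lerD2l ltW.
Qed.

Lemma DensityIs_dup y : DensityIs target (dup y) (g y).
Proof.
apply/DensityP => e e0; have e2 := divr_gt0 e0 (ltr0Sn R 1).
have [N hN] := theta_cvg y e2; have [M hM] := eps_cvg e2.
exists (maxn N M).*2 => n nlt.
suff h : `|dens R K (restr (dup y) n) - theta (restr y n./2)| <= eps n./2.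
  have := hN n./2; have := hM n./2; have nn : (maxn N M <= n./2)%N by lia.
  move=> /(_ (leq_trans (leq_maxr _ _) nn)) a /(_ (leq_trans (leq_maxl _ _) nn)).
  move: h; rewrite ler_norml !ltr_norml => /andP[c d] /andP[i f].
  by apply/andP; split; lra.
rewrite -{1}(odd_double_half n); case: (odd n) => /=; last first.
  by rewrite add0n restr_dup; have := dens_dbl (restr y n./2); rewrite size_mkseq.
(* At odd length the density averages that of the next doubled node with [theta], so it obeys the
   same bound. *)
rewrite add1n restrS restr_dup /dup doubleK dens_half.
have := dens_dbl (rcons (restr y n./2) (y n./2)).
have := theta_rcons (restr y n./2) (y n./2); rewrite size_rcons size_mkseq.
have := eps_le (leqnSn n./2).
rewrite !ler_norml => a /andP[b c] /andP[d f]; apply/andP; split; lra.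
Qed.

Lemma DensityIs_off_diagonal z :
  [\/ exists y, z = dup y, DensityIs target z (0 : R) | DensityIs target z (1 : R)].
Proof.
have [[n]|h] := pselect (exists n, z n.*2 <> z n.*2.+1); last first.
  constructor 1; exists (fun i => z i.*2); apply/funext => i; rewrite /dup.
  rewrite -{1}(odd_double_half i); case: (odd i); rewrite //= add1n.
  by apply: contrapT => ne; apply: h; exists i./2 => zz; apply: ne.
move=> /eqP ne; have [{n ne} n /eqP ne min] := ex_minnP (ex_intro (fun n => z n.*2 != z n.*2.+1) n ne).
have zn : mism z n.
  split=> // i ilt; apply/eqP/negPn/negP => /min.
  by rewrite leqNgt ilt.
have [sm|nsm] := boolP (small z n); [constructor 3|constructor 2];
  apply/DensityP => e e0; exists (n.*2 + n + 2)%N => m hm.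
  rewrite dens_full ?subrr ?normr0 // => y yz.
  by have [yn sE] := mism_Nbhd hm zn yz; apply/(KE yn); rewrite sE.
rewrite dens_unmet ?subrr ?normr0 // => -[y [Ky yz]].
have [yn sE] := mism_Nbhd hm zn yz.
by move/(KE yn): Ky; rewrite sE (negbTE nsm).
Qed.

Lemma realize_density : exists K, [/\ compact K, Sld R K,
  @Usec R K = [set r | 0 < r < 1 /\ exists y, g y = r]
  & (forall y y', 0 < g y < 1 -> g y = g y' -> y = y') -> Rng_inj R K].
Proof.
have uniq z (r r' : R) : DensityIs target z r -> DensityIs target z r' -> r = r'.
  by move=> /DensityP h /DensityP; exact: cvgto_unique h.
have inner z r : DensityIs target z r -> 0 < r < 1 -> exists2 y, z = dup y & g y = r.
  move=> zr /andP[r0 r1]; have [[y zE]|z0|z1] := DensityIs_off_diagonal z.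
  - exists y => //; apply: uniq zr; rewrite zE; exact: DensityIs_dup.
  - by rewrite (uniq _ _ _ zr z0) ltxx in r0.
  - by rewrite (uniq _ _ _ zr z1) ltxx in r1.
exists target; split.
- exact: compact_target.
- move=> z; have [[y ->]|z0|z1] := DensityIs_off_diagonal z.
  + by exists (g y); exact: DensityIs_dup.
  + by exists 0.
  + by exists 1.
- apply/seteqP; split=> r [r01 [z hz]]; split=> //.
    by have [y _ <-] := inner z r hz r01; exists y.
  by exists (dup z); rewrite -hz; exact: DensityIs_dup.
- move=> inj z z' r zr z'r r01.
  have [y -> yr] := inner z r zr r01; have [y' -> y'r] := inner z' r z'r r01.
  by congr dup; apply: inj; rewrite ?yr ?y'r.
Qed.

End Realize.

(** * Coding the points of a closed set by branches of the binary tree *)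

Section Machine.
Variable R : realType.
Variables (C : set (nat -> nat)) (h : (nat -> nat) -> R) (c0 : nat -> nat).
Hypotheses (Cc0 : C c0) (Cclosed : closedB C) (hcont : contB C h).
Hypothesis h01 : forall x, C x -> 0 < h x < 1.

Let through (t : seq nat) : set (nat -> nat) := [set x | C x /\ mkseq x (size t) = t].

(** The default point below [t]: a branch of the binary tree that stays at [t] forever codes it. *)
Let branch (t : seq nat) : nat -> nat := xget c0 (through t).

(** [t'] leaves the default branch of [t] exactly at its last entry. A point through [t] other than
    the default thus has one such [t'] among its initial segments, cut just after the first
    difference. *)
Let dev (t t' : seq nat) : Prop :=
  [/\ (size t < size t')%N, exists x, through t' x,
      forall i, (i < (size t').-1)%N -> nth 0%N t' i = branch t i
    & nth 0%N t' (size t').-1 <> branch t (size t').-1].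

Let state := option (seq nat * nat).

(* Zeros increment a counter; a one replaces the current node by the deviation from its
   default branch whose code the counter shows.  The restriction to proper deviations
   makes the code of each point unique. *)
Let step (st : state) (b : bool) : state :=
  if st is Some (t, c) then
    if b then
      if pickle_inv c is Some t' then if `[< dev t t' >] then Some (t', 0%N) else None
      else None
    else Some (t, c.+1)
  else None.

Let run (s : seq bool) : state := foldl step (Some ([::], 0%N)) s.

Let run_rcons s b : run (rcons s b) = step (run s) b.
Proof. exact: foldl_rcons. Qed.

Let branchP t : (exists x, through t x) -> through t (branch t).
Proof. by move=> ex; exact: (xgetPex c0 ex). Qed.

Let pickle_invE c (t' : seq nat) : pickle_inv c = Some t' -> pickle t' = c.
Proof. by move=> e; have := @pickle_invK (seq nat) c; rewrite e. Qed.

Let step_live st t c b : step st b = Some (t, c) ->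
  exists t1 c1, st = Some (t1, c1) /\
  ((b = false /\ t = t1 /\ c = c1.+1) \/
   (b = true /\ c = 0%N /\ dev t1 t /\ pickle t = c1)).
Proof.
case: st => [[t1 c1]|] //= e; exists t1, c1; split=> //; case: b e; last first.
  by case=> <- <-; left.
case E: (pickle_inv c1) => [t'|] //; case: asboolP => // d [<- <-]; right; split=> //.
by split=> //; split=> //; exact: pickle_invE.
Qed.

Let run_through s t c : run s = Some (t, c) -> through t (branch t).
Proof.
elim/last_ind: s t c => [t c [<- _]|s b IH t c].
  by apply: branchP; exists c0.
rewrite run_rcons => /step_live[t1 [c1 [/IH ? [[_ [-> _]]|[_ [_ [[_ ex _ _] _]]]]]]] //.
exact: branchP.
Qed.

Let dev_prefix t t' : through t (branch t) -> dev t t' -> prefix t t'.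
Proof.
move=> [_ bt] [st _ ag _]; apply/prefixP; exists (drop (size t) t').
rewrite -{1}(cat_take_drop (size t) t'); congr (_ ++ _).
apply: (eq_from_nth (x0 := 0%N)); rewrite size_takel ?(ltnW st) // => i ilt.
rewrite nth_take // ag; last by lia.
by rewrite -[RHS](congr1 (nth 0%N ^~ i) bt) nth_mkseq.
Qed.

Let run_prefix (y : cantor_space) m n t c t' c' : (m <= n)%N ->
  run (restr y m) = Some (t, c) -> run (restr y n) = Some (t', c') -> prefix t t'.
Proof.
move=> mn; rewrite -(subnK mn); elim: (n - m)%N t' c' => [|k IH] t' c' rm.
  by rewrite add0n rm => -[<- _]; exact: prefix_refl.
rewrite addSn restrS run_rcons => /step_live[t1 [c1 [r1 [[_ [-> _]]|[_ [_ [d _]]]]]]].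
  exact: IH r1.
by apply: prefix_trans (IH _ _ rm r1) (dev_prefix (run_through r1) d).
Qed.

Let run_live (y : cantor_space) m n st : (m <= n)%N -> run (restr y n) = Some st ->
  exists st', run (restr y m) = Some st'.
Proof.
move=> mn; rewrite -(subnK mn); elim: (n - m)%N st => [|k IH] st.
  by rewrite add0n => ->; exists st.
rewrite addSn restrS run_rcons; case: st => t c.
by move=> /step_live[t1 [c1 [r1 _]]]; exact: IH r1.
Qed.

(** The last clause covers both ways in which a branch can settle: at one node forever, or through
    nodes of growing length. *)
Let codes (y : cantor_space) (x : nat -> nat) : Prop :=
  [/\ C x,
      forall n, exists t c, run (restr y n) = Some (t, c) /\ mkseq x (size t) = t
    & forall m, exists N, forall n t c, (N <= n)%N -> run (restr y n) = Some (t, c) ->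
        agree m x (branch t)].

Let mkseq_prefix (x : nat -> nat) t t' :
  prefix t t' -> mkseq x (size t') = t' -> mkseq x (size t) = t.
Proof.
move=> /prefixP[u ->] e; apply: (eq_from_nth (x0 := 0%N)); rewrite size_mkseq // => i ilt.
have := congr1 (nth 0%N ^~ i) e; rewrite !nth_mkseq // ?nth_cat ?ilt //.
by rewrite size_cat; lia.
Qed.

(** A live branch with finitely many ones ends at a node and codes its default point. With
    infinitely many ones the nodes grow, and their union is in [C] because [C] is closed. *)
Let codes_total y :
  (exists N, forall n, (N <= n)%N -> run (restr y n) = None) \/ exists x, codes y x.
Proof.
have [[N dead]|live] := pselect (exists N, run (restr y N) = None).
  left; exists N => n Nn; case E: (run _) => [st|] //.
  by have [st'] := run_live Nn E; rewrite dead.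
right.
have ex n : exists tc, run (restr y n) = Some tc.
  by case E: (run (restr y n)) => [tc|]; [exists tc|case: live; exists n].
have {ex live}[T hT] := choice ex.
have TE n t c : run (restr y n) = Some (t, c) -> t = (T n).1.
  by rewrite hT => -[->].
have hT' n : run (restr y n) = Some ((T n).1, (T n).2) by rewrite hT; case: (T n).
have Tpre m n : (m <= n)%N -> prefix (T m).1 (T n).1.
  by move=> mn; apply: (run_prefix mn (hT' m) (hT' n)).
have thr n := run_through (hT' n).
have [[N hN]|inf] := pselect (exists N, forall n, (N <= n)%N -> y n = false).
  have const n : (N <= n)%N -> (T n).1 = (T N).1.
    move=> Nn; rewrite -(subnK Nn); elim: (n - N)%N => [|k IH] //.
    have := hT' (k.+1 + N)%N; rewrite addSn restrS run_rcons hN ?leq_addl //.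
    by move=> /step_live[t1 [c1 [/TE -> [[_ [-> _]]|[]//]]]].
  have [Cb bE] := thr N; exists (branch (T N).1); split=> //.
    move=> n; exists (T n).1, (T n).2; split=> //.
    have [nN|/ltnW/const -> //] := leqP n N.
    exact: mkseq_prefix (Tpre _ _ nN) bE.
  by move=> m; exists N => n t c Nn /TE ->; rewrite const.
have grow k : exists n, (k <= size (T n).1)%N.
  elim: k => [|k [n kn]]; first by exists 0%N.
  have [p [np yp]] : exists p, (n <= p)%N /\ y p.
    apply: contrapT => nex; apply: inf; exists n => p np.
    by apply/negP => yp; apply: nex; exists p.
  exists p.+1; have := hT' p.+1; rewrite restrS run_rcons.
  move=> /step_live[t1 [c1 [/TE -> [[]|[_ [_ [[lt _ _ _] _]]]]]]]; first by rewrite yp.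
  by apply: leq_ltn_trans lt; apply: leq_trans kn (size_prefix (Tpre _ _ np)).
have {grow}[nn hn] := choice grow.
pose x i := nth 0%N (T (nn i.+1)).1 i.
have pnth m n i : (i < size (T m).1)%N -> (i < size (T n).1)%N ->
    nth 0%N (T m).1 i = nth 0%N (T n).1 i.
  by case/orP: (leq_total m n) => /Tpre/prefixP[u ->] h1 h2; rewrite nth_cat ?h1 ?h2.
have xT n : mkseq x (size (T n).1) = (T n).1.
  apply: (eq_from_nth (x0 := 0%N)); rewrite size_mkseq // => i ilt.
  by rewrite nth_mkseq // /x; apply: pnth => //; exact: hn.
have agr m n : (nn m <= n)%N -> agree m x (branch (T n).1).
  move=> mn; have sm : (m <= size (T n).1)%N.
    by apply: leq_trans (hn m) (size_prefix (Tpre _ _ mn)).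
  apply: agree_le sm _; apply/agree_mkseq; rewrite xT; exact: (thr n).2.
exists x; split.
- apply: Cclosed => m; exists (branch (T (nn m)).1); first exact: (thr _).1.
  exact: agr.
- by move=> n; exists (T n).1, (T n).2.
- by move=> m; exists (nn m) => n t c mn /TE ->; exact: agr.
Qed.

Let codes_uniq y x x' : codes y x -> codes y x' -> x = x'.
Proof.
move=> [_ lv h1] [_ _ h2]; apply/funext => i.
have [N hN] := h1 i.+1; have [N' hN'] := h2 i.+1.
have [t [c [rt _]]] := lv (maxn N N').
by rewrite -(hN _ _ _ (leq_maxl _ _) rt i) // -(hN' _ _ _ (leq_maxr _ _) rt i).
Qed.

Let on (x : nat -> nat) (t : seq nat) : Prop := mkseq x (size t) = t.

Let dev_on_uniq x t t' t'' : dev t t' -> dev t t'' -> on x t' -> on x t'' -> t' = t''.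
Proof.
wlog le : t' t'' / (size t' <= size t'')%N => [wl d1 d2 x1 x2|].
  by case/orP: (leq_total (size t') (size t'')) => le; [|symmetry]; exact: wl.
move=> [s1 _ _ ne] [s2 _ ag _] x1 x2.
have sz : size t' = size t''.
  apply/eqP; rewrite eqn_leq le leqNgt; apply/negP => lt; apply: ne.
  have nx s i : on x s -> (i < size s)%N -> nth 0%N s i = x i.
    by move=> e ilt; rewrite -[RHS](nth_mkseq 0%N x ilt) e.
  rewrite -ag; last by lia.
  by rewrite !nx //; lia.
by rewrite -x1 -x2 sz.
Qed.

Let gbit (x : nat -> nat) (st : state) : bool :=
  if st is Some (t, c) then
    if pickle_inv c is Some t' then `[< dev t t' /\ on x t' >] else false
  else false.


(** A code of [x] must move as soon as the counter shows the deviation [t'] of [x]: if it waits, the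
    counter never shows [t'] again, and no other deviation lies on [x]. The branch would stay at [t]
    forever and code the default point, which differs from [x] at the last entry of [t']. *)
Let codes_gbit y x n : codes y x -> y n = gbit x (run (restr y n)).
Proof.
move=> [Cx lv lim]; have [t [c [rn xt]]] := lv n; rewrite rn.
have [t1 [c1 [rn1 xt1]]] := lv n.+1.
move: (rn1); rewrite restrS run_rcons rn => /step_live[t2 [c2 [[<- <-]]]].
case=> [[yn [tE cE]]|[yn [_ [d pE]]]]; rewrite yn; last first.
  by rewrite /gbit -pE pickleK_inv; apply/esym/asboolP.
apply/esym/negbTE/negP; rewrite /gbit.
case E: (pickle_inv c) => [t'|] // /asboolP[d xt'].
have pE := pickle_invE E.
have stay k : run (restr y (n.+1 + k)) = Some (t, (c.+1 + k)%N).
  elim: k => [|k IH]; first by rewrite !addn0 rn1 tE cE.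
  have [u [e [ru xu]]] := lv (n.+1 + k).+1.
  rewrite !addnS; move: (ru); rewrite restrS run_rcons IH => /step_live[t3 [c3 [[<- <-]]]].
  case=> [[-> _]|[_ [_ [d' pE']]]] //.
  have tt := dev_on_uniq d d' xt' xu; move: pE'; rewrite -tt pE; lia.
have [N hN] := lim (size t').
have := hN (n.+1 + N)%N _ _ (leq_addl _ _) (stay N).
case: d => s1 _ _ ne ag; have sp : ((size t').-1 < size t')%N.
  by rewrite ltn_predL (leq_ltn_trans _ s1).
by apply: ne; rewrite ag // -[LHS](congr1 (nth 0%N ^~ (size t').-1) xt') nth_mkseq.
Qed.

Let codes_inj y y' x : codes y x -> codes y' x -> y = y'.
Proof.
move=> yx y'x; suff e n : restr y n = restr y' n.
  by apply/funext => i; rewrite (codes_gbit i yx) (codes_gbit i y'x) e.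
by elim: n => // n IH; rewrite !restrS (codes_gbit n yx) (codes_gbit n y'x) IH.
Qed.

Let greedy (x : nat -> nat) : nat -> state :=
  fix st n := if n is n'.+1 then step (st n') (gbit x (st n')) else Some ([::], 0%N).

Let codes_ex x : C x -> exists y, codes y x.
Proof.
move=> Cx; pose y : cantor_space := fun n => gbit x (greedy x n); exists y.
have runE n : run (restr y n) = greedy x n.
  by elim: n => // n IH; rewrite restrS run_rcons IH.
(* Invariant: the node lies on [x], and the counter has not passed the code of a deviation along
   [x]. *)
have inv n : exists t c, [/\ greedy x n = Some (t, c), on x t &
    forall t', dev t t' -> on x t' -> (c <= pickle t')%N].
  elim: n => [|n [t [c [gE xt cle]]]]; first by exists [::], 0%N.
  rewrite /= gE; case G: (gbit x (Some (t, c))) => /=; last first.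
    exists t, c.+1; split=> // t' d xt'; rewrite ltn_neqAle cle // andbT.
    apply/negP => /eqP cE; move: G; rewrite /gbit cE pickleK_inv => /negP; apply.
    exact/asboolP.
  move: G; rewrite /gbit; case: (pickle_inv c) => [t'|] // /asboolP[d xt'].
  by rewrite asboolT //; exists t', 0%N.
have [[N dead]|[x' x'y]] := codes_total y.
  by have [t [c [gE _ _]]] := inv N; have := dead N (leqnn N); rewrite runE gE.
suff -> : x = x' by [].
have [Cx' lv lim] := x'y.
apply: contrapT => ne.
have [j [jlt jne]] : exists j, (forall i, (i < j)%N -> x i = x' i) /\ x j <> x' j.
  have ex : exists j, x j != x' j.
    by apply: contrapT => nex; apply: ne; apply/funext => i; apply: contrapT => e;
       apply: nex; exists i; exact/eqP.
  have [j /eqP jne jmin] := ex_minnP ex; exists j; split=> // i ilt.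
  by apply/eqP/negPn/negP => /jmin; rewrite leqNgt ilt.
have [N hN] := lim j.+1.
(* Beyond [N] the default branches follow [x'] at [j], so the node cannot reach length
   [j+1]: the counter runs forever although it should stop at the code of [x] cut after
   [j]. *)
pose t' := mkseq x j.+1.
have dv n t c : (N <= n)%N -> greedy x n = Some (t, c) -> dev t t'.
  move=> Nn gE; have ag := hN n t c Nn; rewrite runE in ag; have {}ag := ag gE.
  have [t1 [c1 [g1 xt _]]] := inv n; move: g1; rewrite gE => -[te _]; rewrite -te in xt.
  have thr : through t (branch t) by apply: (@run_through (restr y n) t c); rewrite runE.
  split.
  - rewrite size_mkseq ltnS leqNgt; apply/negP => js; apply: jne.
    have [_ bt] := thr.
    rewrite -(ag j) // -(nth_mkseq 0%N x js) xt -{1}bt nth_mkseq //.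
  - by exists x; split=> //; rewrite size_mkseq.
  - rewrite size_mkseq /= => i ilt; rewrite nth_mkseq; last exact: ltnW.
    by rewrite ag ?jlt //; exact: ltnW.
  - by rewrite size_mkseq /= nth_mkseq // ag.
have xt' : on x t' by rewrite /on size_mkseq.
have bound k : exists t c, greedy x (N + k) = Some (t, c) /\ (k <= c)%N.
  elim: k => [|k [t [c [gE kc]]]].
    by have [t [c [gE _ _]]] := inv N; exists t, c; rewrite addn0.
  have [t1 [c1 [g1 x1 _]]] := inv (N + k).+1.
  rewrite addnS; exists t1, c1; split=> //.
  move: (g1); rewrite /= gE => /step_live[t2 [c2 [[<- <-] [[_ [_ ->]]//|[_ [_ [d _]]]]]]].
  have d' := dv _ _ _ (leq_addr k N) gE.
  have tt := dev_on_uniq d' d xt' x1.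
  by have [] := dv _ _ _ (leqW (leq_addr k N)) g1; rewrite -tt ltnn.
have [t [c [gE lt]]] := bound (pickle t').+1.
have [t1 [c1 [g1 _ cle]]] := inv (N + (pickle t').+1)%N.
move: g1; rewrite gE => -[te ce].
have := cle t'; rewrite -te -ce => /(_ (dv _ _ _ (leq_addr _ N) gE) xt').
by rewrite leqNgt lt.
Qed.

Lemma realize_closed_image_nonempty : exists K,
  [/\ compact K, Sld R K, @Usec R K = h @` C
    & (forall x y, C x -> C y -> h x = h y -> x = y) -> Rng_inj R K].
Proof.
(* Dead nodes get 0, so a branch coding no point has a limit outside (0;1) and adds no value. *)
pose tau s := if run s is Some (t, _) then h (branch t) else 0.
pose lim y := [set x | codes y x].
pose g y := if `[< exists x, codes y x >] then h (xget c0 (lim y)) else 0.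
have gE y x : codes y x -> g y = h x.
  move=> yx; rewrite /g asboolT; last by exists x.
  congr h; apply: (codes_uniq _ yx).
  exact: (xgetPex c0 (ex_intro (fun x => lim y x) x yx)).
have g0 y : ~ (exists x, codes y x) -> g y = 0 by move=> nex; rewrite /g asboolF.
have tau01 s : 0 <= tau s <= 1.
  rewrite /tau; case E: (run s) => [[t c]|]; last by rewrite lexx ler01.
  by have [/h01/andP[/ltW-> /ltW->]] := run_through E.
have tau_cvg (y : cantor_space) : cvgto (fun n => tau (restr y n)) (g y).
  move=> e e0; have [[x yx]|nex] := pselect (exists x, codes y x).
    have [Cx lv lm] := yx; have [m hm] := hcont Cx e0; have [N hN] := lm m.
    exists N => n Nn; have [t [c [rt _]]] := lv n.
    rewrite (gE y x yx) /tau rt; apply: hm; last exact: hN rt.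
    by have [] := run_through rt.
  have [[N dead]|//] := codes_total y; exists N => n Nn.
  by rewrite g0 // /tau dead // subrr normr0.
have [K [cK sK UK iK]] := realize_density tau01 tau_cvg.
exists K; split=> //.
  rewrite UK; apply/seteqP; split=> [r [/andP[r0 r1] [y yr]]|_ [x Cx <-]].
    have [[x yx]|nex] := pselect (exists x, codes y x); last first.
      by rewrite -yr g0 // ltxx in r0.
    by exists x; [case: yx|rewrite -yr (gE y x)].
  by split; [exact: h01|have [y yx] := codes_ex Cx; exists y; exact: gE].
move=> hinj; apply: iK => y y' /andP[y0 _] yy'.
have ex u : 0 < g u -> exists x, codes u x.
  by move=> u0; apply: contrapT => nex; rewrite g0 // ltxx in u0.
have [x yx] := ex y y0; rewrite yy' in y0; have [x' y'x'] := ex y' y0.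
have [[Cx _ _] [Cx' _ _]] := (yx, y'x').
move: yy'; rewrite (gE _ _ yx) (gE _ _ y'x') => /(hinj _ _ Cx Cx') xx'.
by apply: codes_inj yx _; rewrite xx'.
Qed.

End Machine.

Section RealizeImage.
Variable R : realType.
Implicit Types (C : set (nat -> nat)) (h : (nat -> nat) -> R) (S P : set R).

Lemma realize_closed_image C h : closedB C -> contB C h -> h @` C `<=` `]0, 1[ ->
  exists K, [/\ compact K, Sld R K, @Usec R K = h @` C
    & (forall x y, C x -> C y -> h x = h y -> x = y) -> Rng_inj R K].
Proof.
move=> cC hC h01; have [->|/set0P[c Cc]] := eqVneq C set0; last first.
  apply: (realize_closed_image_nonempty Cc) => // x Cx.
  by have /= := h01 (h x) (ex_intro2 _ _ x Cx erefl); rewrite in_itv.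
have D0 z : DensityIs set0 z (0 : R).
  apply/DensityP => e e0; exists 0%N => n _.
  by rewrite dens_unmet ?subrr ?normr0 // => -[? []].
have D0_uniq z (r : R) : DensityIs set0 z r -> r = 0.
  by move=> /DensityP zr; have /DensityP := D0 z; exact: cvgto_unique zr.
exists set0; split.
- exact: compact0.
- by move=> z; exists 0.
- rewrite image_set0; apply/seteqP; split=> r // [/andP[r0 _] [z /D0_uniq r00]].
  by rewrite r00 ltxx in r0.
- by move=> _ z1 z2 r /D0_uniq -> _; rewrite ltxx.
Qed.

Lemma analytic_realized S : analytic01 S ->
  exists K, compact K /\ Sld R K /\ @Usec R K = S.
Proof.
move=> [S01 [->|[f [cf SE]]]]; last rewrite -SE in S01 *.
  have cl0 : closedB set0 by move=> x /(_ 0%N)[].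
  have [|||K [cK sK UK _]] := @realize_closed_image set0 (fun=> 0) => //.
    by rewrite image_set0.
  by exists K; rewrite UK image_set0.
have [|||K [cK sK UK _]] := @realize_closed_image setT f => //.
  by move=> x _ e e0; have [n hn] := cf x e e0; exists n => y _; exact: hn.
by exists K; rewrite UK.
Qed.

Lemma coanalytic_realized P : coanalytic01 P ->
  exists K, compact K /\ Sld R K /\ @Ucsec R K = P.
Proof.
move=> [P01 /analytic_realized[K [cK [sK UK]]]]; exists K; split=> //; split=> //.
by rewrite UcsecE UK setDD setIidr.
Qed.

End RealizeImage.

(** * Borel sets as injective images of closed sets *)

Lemma npair_gt0 a b : (0 < 2 ^ a * b.*2.+1)%N.
Proof. by rewrite muln_gt0 expn_gt0. Qed.

Lemma npairE a b : (npair a b).+1 = (2 ^ a * b.*2.+1)%N.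
Proof. by rewrite /npair prednK // npair_gt0. Qed.

Lemma nfst_npair a b : nfst (npair a b) = a.
Proof.
rewrite /nfst npairE lognM ?expn_gt0 // pfactorK // [X in (_ + X)%N](_ : _ = 0%N) ?addn0 //.
by rewrite lognE /= dvdn2 /= odd_double.
Qed.

Lemma nsnd_npair a b : nsnd (npair a b) = b.
Proof. by rewrite /nsnd nfst_npair npairE mulKn ?expn_gt0 //= doubleK. Qed.

Lemma npairK n : npair (nfst n) (nsnd n) = n.
Proof.
apply/eqP; rewrite -eqSS npairE; apply/eqP.
have n0 : (0 < n.+1)%N by [].
have e : (2 ^ nfst n * (n.+1 %/ 2 ^ nfst n))%N = n.+1.
  by rewrite mulnC divnK // /nfst pfactor_dvdnn.
rewrite -[RHS]e; congr (_ * _)%N; rewrite /nsnd.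
have od : odd (n.+1 %/ 2 ^ nfst n).
  rewrite -[odd _]negbK -dvdn2; apply/negP => /dvdnP[k kE].
  have : (2 ^ (nfst n).+1 %| n.+1)%N.
    by rewrite -e kE mulnCA expnSr dvdn_mull.
  by rewrite pfactor_dvdn // ltnn.
case: (n.+1 %/ 2 ^ nfst n)%N od => // m /= /negbTE em.
by rewrite -[in RHS](odd_double_half m) em.
Qed.

Section InjectiveImages.
Variable R : realType.
Implicit Types (A B : set R) (C : set (nat -> nat)) (h : (nat -> nat) -> R).

Definition inj_image A : Prop := exists C h,
  [/\ closedB C, contB C h, (forall x y, C x -> C y -> h x = h y -> x = y)
    & h @` C = A].

Let tl (x : nat -> nat) : nat -> nat := x \o succn.

Let tl_agree n x y : agree n.+1 x y -> agree n (tl x) (tl y).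
Proof. by move=> xy i ilt; rewrite /tl /= xy. Qed.

Let tl_inj x y : x 0%N = y 0%N -> tl x = tl y -> x = y.
Proof.
move=> e0 e; apply/funext => -[|i] //.
by have := congr1 (fun f => f i) e.
Qed.

Let closedB_tl C x : closedB C ->
  (forall n, exists2 y, C (tl y) & agree n x y) -> C (tl x).
Proof.
move=> cC hx; apply: cC => n; have [y Cy xy] := hx n.+1.
by exists (tl y) => //; exact: tl_agree.
Qed.

Lemma inj_image_closed A F : inj_image A -> closed F -> inj_image (A `&` F).
Proof.
move=> [C [h [cC hC inj <-]]] cF; exists (C `&` h @^-1` F), h; split.
- move=> x hx; have Cx : C x.
    by apply: cC => n; have [y [Cy _] xy] := hx n; exists y.
  split=> //; apply: cF => B /nbhs_ballP[e /= e0 eB].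
  have [n hn] := hC x Cx e e0; have [y [Cy Fy] xy] := hx n.
  by exists (h y); split=> //; apply: eB; rewrite /ball /= distrC; exact: hn.
- move=> x [Cx _] e e0; have [n hn] := hC x Cx e e0.
  by exists n => y [Cy _]; exact: hn.
- by move=> x y [Cx _] [Cy _]; exact: inj.
- apply/seteqP; split=> r; first by move=> [x [Cx Fx] <-]; split=> //; exists x.
  by move=> [[x Cx <-] Fx]; exists x.
Qed.

Lemma inj_image_open A G : inj_image A -> open G -> inj_image (A `&` G).
Proof.
move=> [C [h [cC hC inj <-]]] oG.
pose stable n x := forall y, C y -> agree n x y -> G (h y).
have stable_agree n x y : agree n x y -> stable n x -> stable n y.
  by move=> xy sx z Cz yz; apply: sx => //; exact: agree_trans yz.
(* The first coordinate is the least length of a neighbourhood mapped into [G], which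
   makes the open preimage closed. *)
pose D := [set x | [/\ C (tl x), stable (x 0%N) (tl x) &
  forall m, (m < x 0%N)%N -> ~ stable m (tl x)]].
exists D, (h \o tl); split.
- move=> x hx; split.
  + by apply: closedB_tl cC _ => n; have [y [Cy _ _] xy] := hx n; exists y.
  + have [y [_ sy _] xy] := hx (x 0%N).+2; rewrite (xy 0%N) // in sy.
    apply: stable_agree sy; apply: agree_sym; apply: agree_le (tl_agree xy) => //.
  + move=> m mlt; have [y [_ _ ny] xy] := hx (x 0%N).+2; rewrite (xy 0%N) // in ny.
    move=> sx; apply: (ny m mlt); apply: stable_agree sx.
    by apply: agree_le (tl_agree xy); lia.
- move=> x [Cx _ _] e e0; have [n hn] := hC _ Cx e e0; exists n.+1 => y [Cy _ _] xy.
  by apply: hn => //; exact: tl_agree.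
- move=> x y [Cx sx nx] [Cy sy ny] /= /(inj _ _ Cx Cy) txy; apply: tl_inj => //.
  rewrite txy in sx nx.
  by case: (ltngtP (x 0%N) (y 0%N)) => // lt; [case: (ny _ lt)|case: (nx _ lt)].
- apply/seteqP; split=> r.
    by move=> [x [Cx sx _] <-]; split; [exists (tl x)|exact: sx].
  move=> [[x Cx <-] Gx]; have [e /= e0 eG] : nbhs_ball (h x) G.
    by apply/nbhs_ballP; exact: open_nbhs_nbhs.
  have [n hn] := hC x Cx e e0.
  have ex : exists n, `[< stable n x >].
    exists n; apply/asboolP => y Cy xy; apply: eG.
    by rewrite /ball /= distrC; exact: hn.
  have [m /asboolP sm mmin] := ex_minnP ex.
  exists (fun i => if i is i'.+1 then x i' else m) => //.
  by split=> // k km sk; move: km; rewrite ltnNge mmin //; exact/asboolP.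
Qed.

(** The first coordinate is the index of the set; disjointness recovers it from the value. *)
Lemma inj_image_disjoint_bigcup (A : nat -> set R) : (forall n, inj_image (A n)) ->
  (forall m n r, A m r -> A n r -> m = n) -> inj_image (\bigcup_n A n).
Proof.
move=> hA disj; have [C hC] := choice hA; have [h {}hC] := choice hC.
exists [set x | C (x 0%N) (tl x)], (fun x => h (x 0%N) (tl x)); split.
- move=> x hx; have [cC _ _ _] := hC (x 0%N); apply: cC => n.
  have [y Cy xy] := hx n.+1; rewrite /= (xy 0%N) // in Cy.
  by exists (tl y) => //; exact: tl_agree.
- move=> x Cx e e0; have [_ ct _ _] := hC (x 0%N).
  have [n hn] := ct _ Cx e e0; exists n.+1 => y Cy xy.
  move: Cy; rewrite /= (xy 0%N) // => Cy; apply: hn => //; exact: tl_agree.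
- move=> x y Cx Cy exy; have xy0 : x 0%N = y 0%N.
    apply: (disj _ _ (h (x 0%N) (tl x))).
      by have [_ _ _ <-] := hC (x 0%N); exists (tl x).
    by rewrite exy; have [_ _ _ <-] := hC (y 0%N); exists (tl y).
  apply: tl_inj => //; have [_ _ inj _] := hC (x 0%N).
  by apply: inj => //; rewrite ?exy xy0.
- apply/seteqP; split=> r.
    by move=> [x Cx <-]; exists (x 0%N) => //; have [_ _ _ <-] := hC (x 0%N); exists (tl x).
  move=> [n _]; have [_ _ _ <-] := hC n; move=> [x Cx <-].
  by exists (fun i => if i is i'.+1 then x i' else n).
Qed.

Let sec (n : nat) (x : nat -> nat) : nat -> nat := fun m => x (npair n m).

Let sec_agree n k : exists N, forall x y, agree N x y -> agree k (sec n x) (sec n y).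
Proof.
exists (\max_(m < k) npair n m).+1 => x y xy m mk; rewrite /sec xy // ltnS.
exact: (leq_bigmax (Ordinal mk)).
Qed.

(** A point consists of one section per set, all required to have the same image. This is a closed
    condition by continuity, and the common value determines every section. *)
Lemma inj_image_bigcap (A : nat -> set R) : (forall n, inj_image (A n)) ->
  inj_image (\bigcap_n A n).
Proof.
move=> hA; have [C hC] := choice hA; have [h {}hC] := choice hC.
have near n x (e : R) : C n (sec n x) -> 0 < e -> exists N, forall y, C n (sec n y) ->
    agree N x y -> `|h n (sec n y) - h n (sec n x)| < e.
  move=> Cx e0; have [_ ct _ _] := hC n; have [k hk] := ct _ Cx e e0.
  by have [N hN] := sec_agree n k; exists N => y Cy xy; apply: hk => //; exact: hN.
exists [set x | forall n, C n (sec n x) /\ h n (sec n x) = h 0%N (sec 0%N x)],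
  (fun x => h 0%N (sec 0%N x)); split.
- move=> x hx; have Cx n : C n (sec n x).
    have [cC _ _ _] := hC n; apply: cC => k; have [N hN] := sec_agree n k.
    have [y Dy xy] := hx N; exists (sec n y); first by case: (Dy n).
    exact: hN.
  move=> n; split=> //.
  apply/eqP; rewrite -subr_eq0 -normr_eq0; apply/eqP/le_anti.
  rewrite normr_ge0 andbT; apply/ler_addgt0Pr => e e0; rewrite add0r.
  have e2 := divr_gt0 e0 (ltr0Sn R 1).
  have [N hN] := near n x _ (Cx n) e2; have [M hM] := near 0%N x _ (Cx 0%N) e2.
  have [y Dy xy] := hx (maxn N M).
  have := hN y (Dy n).1 (agree_le (leq_maxl _ _) xy).
  have := hM y (Dy 0%N).1 (agree_le (leq_maxr _ _) xy); rewrite (Dy n).2.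
  rewrite ler_norml !ltr_norml => /andP[a b] /andP[c d]; apply/andP; split; lra.
- move=> x Dx e e0; have [N hN] := near 0%N x e (Dx 0%N).1 e0.
  by exists N => y Dy; apply: hN; case: (Dy 0%N).
- move=> x y Dx Dy xy; apply/funext => i; rewrite -(npairK i).
  suff : sec (nfst i) x = sec (nfst i) y by move/(congr1 (fun f => f (nsnd i))).
  have [_ _ inj _] := hC (nfst i).
  have [[Cx ex] [Cy ey]] := (Dx (nfst i), Dy (nfst i)).
  by apply: inj => //; rewrite ex ey.
- apply/seteqP; split=> r.
    by move=> [x Dx <-] n _; have [_ _ _ <-] := hC n; have [Cx <-] := Dx n; exists (sec n x).
  move=> hr; have ex n : exists x, C n x /\ h n x = r.
    by have := hr n I; have [_ _ _ <-] := hC n => -[x Cx xr]; exists x.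
  have [x hx] := choice ex.
  pose z i := x (nfst i) (nsnd i).
  have zx n : sec n z = x n.
    by apply/funext => m; rewrite /sec /z nfst_npair nsnd_npair.
  exists z; last by rewrite zx; case: (hx 0%N).
  by move=> n; rewrite !zx; have [? ->] := hx n; have [_ ->] := hx 0%N.
Qed.

(** * A continuous bijection from Baire space onto []0, 1]] *)

Section RunLengths.
(* [x] codes the binary expansion with infinitely many ones whose successive runs of zeros
   have lengths [x 0], [x 1], ...; every point of ]0, 1] has exactly one. *)
Let len (x : nat -> nat) n : R := hp R (\sum_(i < n) (x i).+1).
Let lo (x : nat -> nat) n : R := \sum_(i < n) len x i.+1.

Let lenS x n : len x n.+1 = len x n * hp R (x n).+1.
Proof. by rewrite /len big_ord_recr /= hpD. Qed.

Let loS x n : lo x n.+1 = lo x n + len x n.+1.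
Proof. by rewrite /lo big_ord_recr. Qed.

Let len_gt0 x n : 0 < len x n. Proof. exact: hp_gt0. Qed.

Let len_half x n : len x n.+1 + len x n.+1 <= len x n.
Proof.
rewrite lenS -mulrDr -hpS ger_pMr //; exact: hp_le1.
Qed.

Let len_le x n : len x n <= hp R n.
Proof.
apply: hp_le; rewrite -{1}(card_ord n) -sum1_card.
by apply: leq_sum.
Qed.

Let lo_itv x n k : lo x n <= lo x (n + k) <= lo x n + len x n - len x (n + k).
Proof.
elim: k => [|k /andP[IH1 IH2]]; first by rewrite addn0 addrK lexx.
rewrite addnS loS; have := len_half x (n + k); have := len_gt0 x (n + k).+1.
by move=> a b; apply/andP; split; lra.
Qed.

Let val (x : nat -> nat) : R := xget 0 [set l | cvgto (lo x) l].

Let valP x : cvgto (lo x) (val x).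
Proof.
apply: (xgetPex 0 (P := [set l | cvgto (lo x) l])); apply: cvgto_complete => e /hp_arch[k ke].
exists k => m n km kn; have := len_le x k.
have := lo_itv x k (m - k)%N; have := lo_itv x k (n - k)%N; rewrite !subnKC //.
have := len_gt0 x m; have := len_gt0 x n.
move=> a b /andP[c d] /andP[f g] i; rewrite ler_norml; apply/andP; split; lra.
Qed.

(** The left end is never attained because a further one always follows; the right end is attained
    when all later runs of zeros are empty. *)
Let val_itv x n : lo x n < val x <= lo x n + len x n.
Proof.
have itv m : lo x m <= val x <= lo x m + len x m.
  have : `|val x - (lo x m + len x m / 2%:R)| <= len x m / 2%:R.
    apply: (cvgto_dist_le (N := m) (valP x)) => k mk.
    have := lo_itv x m (k - m)%N; rewrite subnKC // => /andP[a b].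
    by have := len_gt0 x k => c; rewrite ler_norml; apply/andP; split; lra.
  by rewrite ler_norml => /andP[a b]; apply/andP; split; lra.
have /andP[_ ->] := itv n; rewrite andbT; have /andP[+ _] := itv n.+1.
by rewrite loS; have := len_gt0 x n.+1; lra.
Qed.

Let agree_lo n x y : agree n x y -> lo y n = lo x n /\ len y n = len x n.
Proof.
move=> xy; have ag m : (m <= n)%N -> len y m = len x m.
  move=> mn; congr (hp R _); apply: eq_bigr => i _; rewrite xy //.
  exact: leq_trans (ltn_ord i) mn.
by split; [apply: eq_bigr => i _; apply: ag|exact: ag].
Qed.

Let digit_uniq (t : R) m n : hp R m.+1 < t <= hp R m -> hp R n.+1 < t <= hp R n -> m = n.
Proof.
move=> /andP[a b] /andP[c d]; case: (ltngtP m n) => // lt; exfalso.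
  by have := hp_le R lt; lra.
by have := hp_le R lt; lra.
Qed.

Let digit_ex (t : R) : exists k, 0 < t <= 1 -> hp R k.+1 < t <= hp R k.
Proof.
have [/andP[t0 t1]|_] := boolP (0 < t <= 1); last by exists 0%N.
have ex : exists k, hp R k < t by exact: hp_arch.
have [[|k] kt kmin] := ex_minnP ex; first by move: kt; rewrite hp0; lra.
exists k => _; rewrite kt leNgt; apply/negP => /kmin.
by rewrite ltnn.
Qed.

Lemma inj_image_itv : inj_image `]0, 1].
Proof.
exists setT, val; split=> //.
- move=> x _ e /hp_arch[n ne]; exists n => y _ xy.
  have [e1 e2] := agree_lo xy; have := val_itv x n; have := val_itv y n.
  rewrite e1 e2; have := len_le x n => a /andP[b c] /andP[d f].
  by rewrite ltr_norml; apply/andP; split; lra.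
- move=> x y _ _ xy; suff ag n : agree n x y.
    by apply/funext => i; rewrite (ag i.+1).
  elim: n => // n IH i; rewrite ltnS leq_eqVlt => /predU1P[->|]; last exact: IH.
  have [e1 e2] := agree_lo IH.
  (* The remainder after [n] runs, rescaled to []0, 1]], lies in the dyadic interval whose index is
     the next run length. *)
  have dig z : hp R (z n).+1 < (val z - lo z n) / len z n <= hp R (z n).
    have := val_itv z n.+1; rewrite loS -addrA lenS -mulrDr -hpS => /andP[a b].
    rewrite ltr_pdivlMr ?len_gt0 // ler_pdivrMr ?len_gt0 //; apply/andP; split; lra.
  by apply: digit_uniq (dig y) _; rewrite e1 e2 -xy; exact: dig.
- apply/seteqP; split=> r.
    move=> [x _ <-]; have := val_itv x 0%N.
    by rewrite /lo /len !big_ord0 hp0 add0r /= in_itv.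
  rewrite /= in_itv /= => r01; have [dg hdg] := choice digit_ex.
  (* [t n] is the rescaled remainder of [r]: multiplying shifts the next run of zeros and its one to
     the front, and subtracting 1 deletes the one. *)
  pose t n : R := iter n (fun t => t * 2%:R ^+ (dg t).+1 - 1) r.
  pose x n := dg (t n).
  have t01 n : 0 < t n <= 1.
    elim: n => // n IH; have := hdg _ IH => /andP[a b].
    rewrite /= subr_gt0 lerBlDr (_ : 1 + 1 = 2%:R) //.
    have p0 : 0 < (2%:R : R) ^+ (dg (t n)).+1 by rewrite exprn_gt0.
    have {}a : hp R (dg (t n)).+1 * 2%:R ^+ (dg (t n)).+1 < t n * 2%:R ^+ (dg (t n)).+1.
      by rewrite ltr_pM2r.
    have {}b : t n * 2%:R ^+ (dg (t n)).+1 <= hp R (dg (t n)) * 2%:R ^+ (dg (t n)).+1.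
      by rewrite ler_pM2r.
    rewrite hpK in a; rewrite a /=; apply: le_trans b _.
    by rewrite exprS mulrCA hpK mulr1.
  have rE n : r = lo x n + len x n * t n.
    elim: n => [|n IH]; first by rewrite /lo /len !big_ord0 hp0 add0r mul1r.
    rewrite {1}IH loS lenS -addrA; congr (_ + _).
    rewrite -[X in X + _]mulr1 -mulrDr /= addrCA subrr addr0 -mulrA; congr (_ * _).
    by rewrite mulrCA -/(x n) hpK mulr1.
  exists x => //; apply: cvgto_unique (valP x) _ => e /hp_arch[k ke].
  exists k => n kn; have := rE n; have /andP[a b] := t01 n.
  have := le_trans (len_le x n) (hp_le R kn); have l0 := len_gt0 x n => c ->.
  rewrite opprD addrA subrr sub0r normrN gtr0_norm ?mulr_gt0 //.
  by apply: le_lt_trans ke; apply: le_trans c; rewrite ger_pMr.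
Qed.
End RunLengths.

(** Carrying the complement along makes the class a sigma-algebra: a union is first made disjoint by
    removing the earlier sets, and this intersects with their complements. *)
Lemma borel_inj_image B : borel B -> inj_image (`]0, 1[ `&` B) /\ inj_image (`]0, 1[ `\` B).
Proof.
have J01 : inj_image `]0, 1[.
  rewrite (_ : [set` _] = `]0, 1] `&` `]-oo, 1[).
    by apply: inj_image_open; [exact: inj_image_itv|exact: interval_open].
  apply/seteqP; split=> r; rewrite /= !in_itv /=; first by case/andP => -> /[dup] /ltW -> ->.
  by move=> [/andP[-> _] ->].
pose L : set (set R) := [set B | inj_image (`]0, 1[ `&` B) /\ inj_image (`]0, 1[ `\` B)].
suff : <<s (@open R) >> `<=` L by apply.
apply: smallest_sub; last first.
  move=> G oG; split; first exact: inj_image_open.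
  by rewrite setDE; apply: inj_image_closed => //; exact: open_closedC.
split.
- split; last by rewrite setD0.
  by have := inj_image_closed J01 closed0.
- move=> A [h1 h2]; rewrite setTD; split; first by rewrite -setDE.
  by rewrite setDE setCK.
- move=> F hF; split; last first.
    rewrite (_ : _ `\` _ = \bigcap_i (`]0, 1[ `\` F i)).
      by apply: inj_image_bigcap => i; case: (hF i).
    apply/seteqP; split=> r.
      by move=> [r01 nF] i _; split=> // Fi; apply: nF; exists i.
    move=> hr; split; first by case: (hr 0%N I).
    by move=> [i _ Fi]; case: (hr i I).
  (* [D i] is [F i] without the earlier sets, written as a countable intersection of injective
     images; the indices [m >= i] repeat [F i]. *)
  pose D i := \bigcap_m (if (m < i)%N then `]0, 1[ `\` F m else `]0, 1[ `&` F i).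
  have DP i r : D i r <-> [/\ `]0, 1[%classic r, F i r & forall m, (m < i)%N -> ~ F m r].
    split=> [h|[r01 Fi nF] m _]; last by case: ifP => // /nF.
    have := h i I; rewrite ltnn => -[r01 Fi]; split=> // m mi.
    by have := h m I; rewrite mi => -[].
  rewrite (_ : _ `&` _ = \bigcup_i D i).
    apply: inj_image_disjoint_bigcup => [i|m n r].
      apply: inj_image_bigcap => m; case: ifP => _; first by case: (hF m).
      by case: (hF i).
    move=> /DP[_ Fm nm] /DP[_ Fn nn].
    by case: (ltngtP m n) => // lt; [case: (nn _ lt)|case: (nm _ lt)].
  apply/seteqP; split=> r; last by move=> [i _ /DP[r01 Fi _]]; split=> //; exists i.
  move=> [r01 [i _ Fi]].
  have ex : exists i, `[< F i r >] by exists i; apply/asboolP.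
  have [j /asboolP Fj jmin] := ex_minnP ex; exists j => //; apply/DP; split=> // m mj Fm.
  by move: mj; rewrite ltnNge jmin //; exact/asboolP.
Qed.

Lemma borel_realized B : borel01 B ->
  exists K, compact K /\ Sld R K /\ Rng_inj R K /\ @Usec R K = B.
Proof.
move=> [B01 /borel_inj_image[]]; rewrite setIidr // => -[C [h [cC hC inj hB]]] _.
have [|K [cK sK UK iK]] := realize_closed_image cC hC; first by rewrite hB.
by exists K; rewrite UK; do !split=> //; exact: iK.
Qed.

Lemma coborel_realized B : borel01 B ->
  exists K, compact K /\ Sld R K /\ Rng_inj R K /\ @Ucsec R K = B.
Proof.
move=> [B01 bB]; have [|K [cK [sK [iK UK]]]] := @borel_realized (`]0, 1[ `\` B).
  split; first exact: subDsetl.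
  by apply: borelD => //; apply: borel_open; exact: interval_open.
by exists K; do !split=> //; rewrite UcsecE UK setDD setIidr.
Qed.

End InjectiveImages.

(** * Primitive recursive functions and the Kleene normal form *)

Definition PR (a : nat) (F : seq nat -> nat) : Prop :=
  exists f, forall l, size l = a -> prf_eval f l = F l.

Lemma eval_PRcomp g hs l :
  prf_eval (PRcomp g hs) l = prf_eval g [seq prf_eval h l | h <- hs].
Proof. by congr prf_eval; elim: hs => //= h hs ->. Qed.

Lemma PR_ext a F G : PR a F -> (forall l, size l = a -> F l = G l) -> PR a G.
Proof. by move=> [f hf] FG; exists f => l la; rewrite hf // FG. Qed.

Lemma PR_proj a i : PR a (fun l => nth 0%N l i).
Proof. by exists (PRproj i). Qed.

Lemma PR_proj_drop a i k : PR a (fun l => nth 0%N (drop k l) i).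
Proof. by apply: PR_ext (PR_proj a (k + i)) _ => l _; rewrite nth_drop. Qed.

Definition PR1 (f : nat -> nat) : Prop := PR 1 (fun l => f (nth 0%N l 0)).
Definition PR2 (f : nat -> nat -> nat) : Prop := PR 2 (fun l => f (nth 0%N l 0) (nth 0%N l 1)).

Lemma PR_comp1 a f F : PR1 f -> PR a F -> PR a (fun l => f (F l)).
Proof.
move=> [pf hf] [pF hF]; exists (PRcomp pf [:: pF]) => l la.
by rewrite eval_PRcomp hf //= hF.
Qed.

Lemma PR_comp2 a f F G : PR2 f -> PR a F -> PR a G -> PR a (fun l => f (F l) (G l)).
Proof.
move=> [pf hf] [pF hF] [pG hG]; exists (PRcomp pf [:: pF; pG]) => l la.
by rewrite eval_PRcomp hf //= hF // hG.
Qed.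

Lemma PR_comp3 a (F G1 G2 G3 : seq nat -> nat) : PR 3 F -> PR a G1 -> PR a G2 -> PR a G3 ->
  PR a (fun l => F [:: G1 l; G2 l; G3 l]).
Proof.
move=> [pf hf] [p1 h1] [p2 h2] [p3 h3]; exists (PRcomp pf [:: p1; p2; p3]) => l la.
by rewrite eval_PRcomp hf //= h1 // h2 // h3.
Qed.

Lemma PR1_succ : PR1 succn.
Proof. by exists PRsucc => -[|x []]. Qed.

Lemma PR_const a c : PR a (fun=> c).
Proof.
elim: c => [|c IH]; first by exists PRzero.
exact: (PR_comp1 PR1_succ IH).
Qed.

Fixpoint prec (b : nat) (s : nat -> nat -> nat) (n : nat) : nat :=
  if n is k.+1 then s k (prec b s k) else b.

Lemma eval_PRproj_iota (l : seq nat) k :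
  [seq prf_eval h l | h <- [seq PRproj i | i <- iota k (size l - k)]] = drop k l.
Proof.
rewrite -map_comp; apply: (eq_from_nth (x0 := 0%N)).
  by rewrite size_map size_iota size_drop.
move=> i; rewrite size_map size_iota => ilt.
by rewrite (nth_map 0%N) ?size_iota // nth_iota //= nth_drop.
Qed.

Lemma PR_rec a (N B : seq nat -> nat) (S : nat -> nat -> seq nat -> nat) :
  PR a N -> PR a B -> PR a.+2 (fun l => S (nth 0%N l 0) (nth 0%N l 1) (drop 2 l)) ->
  PR a (fun l => prec (B l) (fun k acc => S k acc l) (N l)).
Proof.
move=> [pN hN] [pB hB] [pS hS].
exists (PRcomp (PRrec pB pS) (pN :: [seq PRproj i | i <- iota 0 a])) => l la.
have := eval_PRproj_iota l 0; rewrite subn0 la drop0 => e.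
rewrite eval_PRcomp map_cons e hN //=; elim: (N l) => [|k IH] /=; first exact: hB.
by rewrite IH hS /= ?la ?drop0.
Qed.

(** The step function of a recursion receives the index, the accumulator and the parameters; this
    makes a function blind to the accumulator usable there. *)
Lemma PR_skip a F : PR a.+1 F -> PR a.+2 (fun l => F (nth 0%N l 0 :: drop 2 l)).
Proof.
move=> [pf hf]; exists (PRcomp pf (PRproj 0 :: [seq PRproj i | i <- iota 2 a])) => l la.
have := eval_PRproj_iota l 2; rewrite la !subSS subn0 => e.
by rewrite eval_PRcomp map_cons e hf //= size_drop la; lia.
Qed.

Lemma PR2_add : PR2 addn.
Proof.
apply: PR_ext (PR_rec (S := fun _ acc _ => acc.+1) (PR_proj 2 0) (PR_proj 2 1) _) _.
  exact: (PR_comp1 PR1_succ (PR_proj _ 1)).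
by move=> l _; elim: (nth _ l 0) => //= n ->; rewrite addSn.
Qed.

Lemma PR_sum a (N : seq nat -> nat) (F : nat -> seq nat -> nat) :
  PR a N -> PR a.+1 (fun l => F (nth 0%N l 0) (drop 1 l)) ->
  PR a (fun l => \sum_(i < N l) F i l)%N.
Proof.
move=> hN hF.
apply: (PR_ext (F := fun l => prec 0 (fun k acc => acc + F k l)%N (N l))).
  apply: (PR_rec (B := fun=> 0%N) (S := fun k acc l => acc + F k l)%N) => //.
    exact: PR_const.
  apply: (PR_comp2 PR2_add (PR_proj _ 1)).
  by apply: PR_ext (PR_skip hF) _ => l _ /=; rewrite drop0.
by move=> l _; elim: (N l) => [|k IH] /=; rewrite ?big_ord0 // big_ord_recr IH.
Qed.

Lemma PR1_pred : PR1 predn.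
Proof.
apply: PR_ext (PR_rec (S := fun k _ _ => k) (PR_proj 1 0) (PR_const 1 0) (PR_proj _ 0)) _.
by move=> l _; case: (nth _ l 0).
Qed.

Lemma PR2_sub : PR2 subn.
Proof.
apply: PR_ext (PR_rec (S := fun _ acc _ => acc.-1) (PR_proj 2 1) (PR_proj 2 0) _) _.
  exact: (PR_comp1 PR1_pred (PR_proj _ 1)).
by move=> l _; elim: (nth _ l 1) => [|n IH] /=; rewrite ?subn0 // subnS IH.
Qed.

Lemma PR2_mul : PR2 muln.
Proof.
apply: PR_ext (PR_rec (S := fun _ acc l => (acc + nth 0 l 1)%N) (PR_proj 2 0) (PR_const 2 0) _) _.
  exact: (PR_comp2 PR2_add (PR_proj _ 1) (PR_proj_drop _ 1 2)).
by move=> l _; elim: (nth _ l 0) => //= n ->; rewrite mulSn addnC.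
Qed.

Lemma PR1_exp2 : PR1 (expn 2).
Proof.
apply: PR_ext (PR_rec (S := fun _ acc _ => (acc + acc)%N) (PR_proj 1 0) (PR_const 1 1) _) _.
  exact: (PR_comp2 PR2_add (PR_proj _ 1) (PR_proj _ 1)).
by move=> l _; elim: (nth _ l 0) => //= n ->; rewrite expnS mul2n addnn.
Qed.

Lemma PR1_double : PR1 double.
Proof.
by apply: PR_ext (PR_comp2 PR2_add (PR_proj 1 0) (PR_proj 1 0)) _ => l _; rewrite addnn.
Qed.

Lemma PR2_max : PR2 maxn.
Proof.
apply: PR_ext (PR_comp2 PR2_add (PR_proj 2 0) (PR_comp2 PR2_sub (PR_proj 2 1) (PR_proj 2 0))) _.
by move=> l _; lia.
Qed.

Lemma PR2_leq : PR2 (fun m n => (m <= n)%N : nat).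
Proof.
apply: PR_ext (PR_comp2 PR2_sub (PR_const 2 1)
  (PR_comp2 PR2_sub (PR_proj 2 0) (PR_proj 2 1))) _ => l _.
by case: (leqP (nth 0%N l 0) (nth 0%N l 1)) => /=; lia.
Qed.

Lemma PR2_eq : PR2 (fun m n => (m == n) : nat).
Proof.
apply: PR_ext (PR_comp2 PR2_mul PR2_leq
  (PR_comp2 PR2_leq (PR_proj 2 1) (PR_proj 2 0))) _ => l _.
by rewrite eqn_leq; case: (_ <= _)%N; case: (_ <= _)%N.
Qed.

Lemma PR2_npair : PR2 npair.
Proof.
apply: PR_ext (PR_comp1 PR1_pred (PR_comp2 PR2_mul (PR_comp1 PR1_exp2 (PR_proj 2 0))
  (PR_comp1 PR1_succ (PR_comp1 PR1_double (PR_proj 2 1))))) _.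
by move=> l _.
Qed.

Lemma leq_nsnd_npair a b : (b <= npair a b)%N.
Proof.
rewrite -ltnS npairE; apply: leq_trans (_ : b.*2.+1 <= _)%N; first by lia.
by rewrite leq_pmull // expn_gt0.
Qed.

Lemma leq_nfst_npair a b : (a <= npair a b)%N.
Proof.
rewrite -ltnS npairE; apply: leq_trans (ltn_expl a (ltnSn 1)) _.
by rewrite leq_pmulr.
Qed.

Lemma sum_pick N x (G : nat -> nat) : (x < N)%N ->
  (\sum_(i < N) (i == x :> nat) * G i = G x)%N.
Proof.
move=> xN; rewrite (bigD1 (Ordinal xN)) //= eqxx mul1n big1 ?addn0 // => i ne.
by rewrite (_ : (i == x :> nat) = false) //; exact/negbTE.
Qed.

Lemma npair_eq a b n : (npair a b == n) = (a == nfst n) && (b == nsnd n).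
Proof.
apply/eqP/andP => [<-|[/eqP-> /eqP->]]; last exact: npairK.
by rewrite nfst_npair nsnd_npair.
Qed.

(** Decoding by bounded search, written as a sum: both components of [n] are at most [n], and only
    the right pair contributes. *)
Lemma search_npair (G : nat -> nat -> nat) n :
  (\sum_(a < n.+1) \sum_(b < n.+1) (npair a b == n) * G a b = G (nfst n) (nsnd n))%N.
Proof.
transitivity (\sum_(a < n.+1) (a == nfst n :> nat) * G a (nsnd n))%N.
  apply: eq_bigr => a _; under eq_bigr => b _ do rewrite npair_eq -mulnb -mulnA.
  rewrite -big_distrr /= sum_pick //.
  by rewrite ltnS -[X in (_ <= X)%N](npairK n) leq_nsnd_npair.
by rewrite (sum_pick (fun a => G a (nsnd n))) // ltnS -[X in (_ <= X)%N](npairK n)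
  leq_nfst_npair.
Qed.

Lemma PR1_search (G : nat -> nat -> nat) : PR2 G -> PR1 (fun n => G (nfst n) (nsnd n)).
Proof.
move=> hG; apply: PR_ext (PR_sum (F := fun a l => \sum_(b < (nth 0%N l 0).+1)
    (npair a b == nth 0%N l 0) * G a b)%N (PR_comp1 PR1_succ (PR_proj 1 0)) _) _.
  apply: PR_ext (PR_sum (F := fun b l => (npair (nth 0%N l 0) b == nth 0%N l 1) *
      G (nth 0%N l 0) b)%N (PR_comp1 PR1_succ (PR_proj 2 1)) _) _.
    apply: (PR_comp2 PR2_mul).
      apply: (PR_comp2 PR2_eq _ (PR_proj_drop _ _ _)).
      exact: (PR_comp2 PR2_npair (PR_proj_drop _ _ _) (PR_proj _ _)).
    exact: (PR_comp2 hG (PR_proj_drop _ _ _) (PR_proj _ _)).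
  by move=> l _; rewrite nth_drop.
by move=> l _; rewrite search_npair.
Qed.

Lemma PR1_nfst : PR1 nfst. Proof. exact: (PR1_search (G := fun a _ => a) (PR_proj 2 0)). Qed.

Lemma PR1_nsnd : PR1 nsnd. Proof. exact: (PR1_search (G := fun _ b => b) (PR_proj 2 1)). Qed.

(** * Codes of finite sequences *)

Definition sdrop (i c : nat) : nat := iter i (fun c => nsnd c.-1) c.

Lemma sdrop_scode i s : sdrop i (scode s) = scode (drop i s).
Proof.
have sdropS j c : sdrop j.+1 c = sdrop j (nsnd c.-1) by exact: iterSr.
elim: i s => [|i IH] s; first by rewrite drop0.
rewrite sdropS; case: s => [|a s]; last by rewrite /= nsnd_npair IH.
(* Dropping an entry from the empty sequence leaves the code 0, since [npair 0 0] is 0. *)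
by rewrite (_ : nsnd _ = scode [::]) ?IH // -[RHS](nsnd_npair 0 0).
Qed.

Lemma PR2_sdrop : PR2 sdrop.
Proof.
apply: PR_ext (PR_rec (S := fun _ acc _ => nsnd acc.-1) (PR_proj 2 0) (PR_proj 2 1) _) _.
  exact: (PR_comp1 PR1_nsnd (PR_comp1 PR1_pred (PR_proj _ 1))).
by move=> l _; rewrite /sdrop; elim: (nth _ l 0) => //= n ->.
Qed.

Definition slook (c i : nat) : nat := nfst (sdrop i c).-1.

Lemma slook_scode s i : (i < size s)%N -> slook (scode s) i = nth 0%N s i.
Proof.
by move=> ilt; rewrite /slook sdrop_scode (drop_nth 0%N ilt) /= nfst_npair.
Qed.

Lemma PR2_slook : PR2 slook.
Proof.
exact: (PR_comp1 PR1_nfst (PR_comp1 PR1_pred (PR_comp2 PR2_sdrop (PR_proj 2 1) (PR_proj 2 0)))).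
Qed.

(** Only the empty sequence has code 0, so the length counts the [i] for which dropping [i] entries
    leaves a positive code; it never exceeds the code, whence the bound of the sum. *)
Definition slen (c : nat) : nat := (\sum_(i < c) (1 <= sdrop i c))%N.

Lemma size_le_scode s : (size s <= scode s)%N.
Proof.
by elim: s => //= a s IH; rewrite ltnS (leq_trans IH) // leq_nsnd_npair.
Qed.

Lemma slen_scode s : slen (scode s) = size s.
Proof.
rewrite /slen; under eq_bigr => i _.
  rewrite sdrop_scode (_ : (1 <= _)%N = (i < size s)%N); first over.
  have [lt|ge] := ltnP i (size s); first by rewrite (drop_nth 0%N lt).
  by rewrite drop_oversize.
rewrite -(subnKC (size_le_scode s)) big_split_ord /= [X in (_ + X)%N]big1 => [|i _].
  under eq_bigr => i _ do rewrite ltn_ord.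
  by rewrite sum1_card card_ord addn0.
by rewrite ltnNge leq_addr.
Qed.

Lemma PR1_slen : PR1 slen.
Proof.
apply: (PR_sum (F := fun i l => (1 <= sdrop i (nth 0%N l 0))%N : nat) (PR_proj 1 0) _).
apply: (PR_comp2 PR2_leq (PR_const _ 1)).
exact: (PR_comp2 PR2_sdrop (PR_proj _ 0) (PR_proj_drop _ 0 1)).
Qed.

(** * Operators with two oracles, computed from finite restrictions *)

(* The value at [m] of an operator calling the oracles [w] and [v]: [cv] computes it from
   finite restrictions as soon as these are longer than [cb], a bound on the queries. *)
Definition OE (F : (nat -> nat) -> (nat -> nat) -> nat -> nat) : Prop :=
  exists cv cb, [/\ PR 3 cv, PR 3 cb & forall w v m,
    let a n := [:: m; scode (mkseq w n); scode (mkseq v n)] in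
    (forall n, (cb (a n) <= n)%N -> cv (a n) = F w v m) /\
    exists n0, forall n, (n0 <= n)%N -> (cb (a n) <= n)%N].

Lemma OE_arg : OE (fun _ _ m => m).
Proof.
exists (fun l => nth 0%N l 0), (fun=> 0%N); split.
- exact: PR_proj.
- exact: PR_const.
- by move=> w v m; split=> //; exists 0%N.
Qed.

Lemma OE_const c : OE (fun _ _ _ => c).
Proof.
exists (fun=> c), (fun=> 0%N); split; try exact: PR_const.
by move=> w v m; split=> //; exists 0%N.
Qed.

Lemma OE_comp1 f F : PR1 f -> OE F -> OE (fun w v m => f (F w v m)).
Proof.
move=> hf [cv [cb [pv pb h]]]; exists (fun l => f (cv l)), cb; split=> //.
  exact: PR_comp1.
by move=> w v m; have [h1 h2] := h w v m; split=> // n /h1 ->.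
Qed.

Lemma OE_comp2 f F G : PR2 f -> OE F -> OE G -> OE (fun w v m => f (F w v m) (G w v m)).
Proof.
move=> hf [cv [cb [pv pb h]]] [cv' [cb' [pv' pb' h']]].
exists (fun l => f (cv l) (cv' l)), (fun l => maxn (cb l) (cb' l)); split.
- exact: PR_comp2.
- exact: (PR_comp2 PR2_max).
- move=> w v m; have [h1 [n1 h2]] := h w v m; have [h1' [n1' h2']] := h' w v m.
  split=> [n|]; first by rewrite geq_max => /andP[/h1-> /h1'->].
  exists (maxn n1 n1') => n; rewrite geq_max => /andP[/h2 a /h2' b].
  by rewrite geq_max a b.
Qed.

(** The bound must also exceed the queried place, which is itself computed from the restrictions and
    is correct once the bound of [F] is met. *)
Lemma OE_query (b : bool) F : OE F -> OE (fun w v m => (if b then v else w) (F w v m)).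
Proof.
move=> [cv [cb [pv pb h]]].
exists (fun l => slook (nth 0%N l (if b then 2 else 1)) (cv l)),
  (fun l => maxn (cb l) (cv l).+1); split.
- exact: (PR_comp2 PR2_slook (PR_proj _ _)).
- by apply: (PR_comp2 PR2_max) => //; exact: PR_comp1 PR1_succ _.
- move=> w v m; have [h1 [n1 h2]] := h w v m; split=> [n|].
    rewrite geq_max => /andP[/h1 -> lt].
    by case: b; rewrite /= slook_scode ?size_mkseq // nth_mkseq.
  exists (maxn n1 (F w v m).+1) => n; rewrite geq_max => /andP[/h2 a b'].
  by rewrite geq_max a (h1 _ a).
Qed.

Lemma OE_w F : OE F -> OE (fun w v m => w (F w v m)).
Proof. exact: (@OE_query false). Qed.

Lemma OE_v F : OE F -> OE (fun w v m => v (F w v m)).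
Proof. exact: (@OE_query true). Qed.

(** The single number [n] of the normal form has two roles: it is the length of the restrictions,
    and [nfst n] is the argument [m]. The test passes by default while [n] is below the query bound.
    Every [m] is eventually tested, since [npair m n0] has first component [m] and is at least
    [n0]. *)
Lemma Sigma11_intro (R : realType) (A : set cantor_space -> R -> Prop) F : OE F ->
  (forall K r w, compact K -> is_name K r w ->
     (A K r <-> exists v, forall m, F w v m != 0%N)) -> Sigma11 A.
Proof.
move=> [cv [cb [pv pb hF]]] hA.
pose a (l : seq nat) := [:: nfst (slen (nth 0%N l 0)); nth 0%N l 0; nth 0%N l 1].
pose g l := (cb (a l) <= slen (nth 0%N l 0))%N.
have [f hf] : PR 2 (fun l => g l * cv (a l) + (1 - g l))%N.
  have pl := PR_comp1 PR1_slen (PR_proj 2 0).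
  have pa F0 : PR 3 F0 -> PR 2 (fun l => F0 (a l)).
    move=> h; exact: (PR_comp3 h (PR_comp1 PR1_nfst pl) (PR_proj 2 0) (PR_proj 2 1)).
  have pg : PR 2 (fun l => g l : nat) by exact: (PR_comp2 PR2_leq (pa _ pb) pl).
  apply: (PR_comp2 PR2_add); first exact: (PR_comp2 PR2_mul pg (pa _ pv)).
  exact: (PR_comp2 PR2_sub (PR_const _ 1) pg).
exists f => K r w cK nm; rewrite (hA K r w cK nm); split=> -[v hv]; exists v.
  move=> n; rewrite hf //= /g /a /= slen_scode size_mkseq.
  have [h1 _] := hF w v (nfst n).
  by case: leqP => [/h1 ->|_]; rewrite ?mul1n ?addn0 ?hv.
move=> m; have [h1 [n0 /(_ _ (leq_nsnd_npair m n0)) h2]] := hF w v m.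
have := hv (npair m n0); rewrite hf //= /g /a /= slen_scode size_mkseq nfst_npair.
by rewrite h2 mul1n addn0 h1.
Qed.

(** * The arithmetical formulas *)

Section Formula.
Variable R : realType.

(** Multiplying by a common denominator [P] turns comparisons of rationals into comparisons of
    natural numbers, which a recursive test can make. *)
Lemma le_cross (x y P : R) (m n : nat) : 0 < P -> (y - x) * P = n%:R - m%:R ->
  (x <= y) = (m <= n)%N.
Proof. by move=> P0 e; rewrite -subr_ge0 -(pmulr_lge0 _ P0) e subr_ge0 ler_nat. Qed.

Lemma lt_cross (x y P : R) (m n : nat) : 0 < P -> (y - x) * P = n%:R - m%:R ->
  (x < y) = (m < n)%N.
Proof. by move=> P0 e; rewrite -subr_gt0 -(pmulr_lgt0 _ P0) e subr_gt0 ltr_nat. Qed.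

(** * Rational inequalities as integer tests *)

Section Tests.
Variables (c c' q j k : nat).
Let a := nfst q.
Let b := nfst (nsnd q).
Let e := (nsnd (nsnd q)).+1.

Definition close : bool :=
  ((c * e * 2 ^ k + b * 2 ^ j * 2 ^ k <= a * 2 ^ j * 2 ^ k + (2 * 2 ^ j * e)) &&
   (a * 2 ^ j * 2 ^ k <= c * e * 2 ^ k + b * 2 ^ j * 2 ^ k + (2 * 2 ^ j * e)))%N.

Definition inside : bool :=
  ((2 * e + b * 2 ^ k < a * 2 ^ k) && (a * 2 ^ k + 2 * e < (b + e) * 2 ^ k))%N.

Definition below : bool := (a * 2 ^ k <= b * 2 ^ k + e)%N.

Definition above : bool := ((b + e) * 2 ^ k <= a * 2 ^ k + e)%N.

Definition far : bool :=
  ((c * 2 ^ k + 2 ^ j <= c' * 2 ^ k) || (c' * 2 ^ k + 2 ^ j <= c * 2 ^ k))%N.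

Let e0 : (e%:R : R) != 0. Proof. by rewrite pnatr_eq0. Qed.
Let p0 n : (2%:R : R) ^+ n != 0. Proof. by rewrite expf_neq0. Qed.
Let q0 n : 0 < (2%:R : R) ^+ n. Proof. by rewrite exprn_gt0. Qed.

Lemma closeP : close = (`|c%:R * hp R j - qdec R q| <= 2%:R * hp R k).
Proof.
rewrite ler_norml andbC /close /qdec -/a -/b -/e /hp; congr (_ && _); apply/esym.
  apply: (@le_cross _ _ (e%:R * 2%:R ^+ j * 2%:R ^+ k)).
    by rewrite !mulr_gt0.
  by rewrite !(natrD, natrM, natrX); field; rewrite e0 !p0.
apply: (@le_cross _ _ (e%:R * 2%:R ^+ j * 2%:R ^+ k)).
  by rewrite !mulr_gt0.
by rewrite !(natrD, natrM, natrX); field; rewrite e0 !p0.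
Qed.

Lemma insideP : inside = (2%:R * hp R k < qdec R q < 1 - 2%:R * hp R k).
Proof.
rewrite /inside /qdec -/a -/b -/e /hp; congr (_ && _); apply/esym.
  apply: (@lt_cross _ _ (e%:R * 2%:R ^+ k)); first by rewrite mulr_gt0.
  by rewrite !(natrD, natrM, natrX); field; rewrite e0 !p0.
apply: (@lt_cross _ _ (e%:R * 2%:R ^+ k)); first by rewrite mulr_gt0.
by rewrite !(natrD, natrM, natrX); field; rewrite e0 !p0.
Qed.

Lemma belowP : below = (qdec R q <= hp R k).
Proof.
rewrite /below /qdec -/a -/b -/e /hp; apply/esym.
apply: (@le_cross _ _ (e%:R * 2%:R ^+ k)); first by rewrite mulr_gt0.
by rewrite !(natrD, natrM, natrX); field; rewrite e0 !p0.
Qed.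

Lemma aboveP : above = (1 - hp R k <= qdec R q).
Proof.
rewrite /above /qdec -/a -/b -/e /hp; apply/esym.
apply: (@le_cross _ _ (e%:R * 2%:R ^+ k)); first by rewrite mulr_gt0.
by rewrite !(natrD, natrM, natrX); field; rewrite e0 !p0.
Qed.

Lemma farP : far = (hp R k <= `|c%:R * hp R j - c'%:R * hp R j|).
Proof.
rewrite ler_normr orbC /far /hp; congr (_ || _); apply/esym.
  apply: (@le_cross _ _ (2%:R ^+ j * 2%:R ^+ k)); first by rewrite mulr_gt0.
  by rewrite !(natrD, natrM, natrX); field; rewrite !p0.
apply: (@le_cross _ _ (2%:R ^+ j * 2%:R ^+ k)); first by rewrite mulr_gt0.
by rewrite !(natrD, natrM, natrX); field; rewrite !p0.
Qed.
End Tests.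

(** * The formula and its oracles *)

Definition orc (v : nat -> nat) (k i : nat) : nat := v (npair k i).

(* The oracles: 0 scalar parameters, 1 and 2 appending a bit to a code, 3 the counting
   function of the tree, 4 and 5 the codes of the prefixes of two points, 6 to 9 moduli of
   convergence for them, 10 a sequence of rationals, 11 to 13 witnesses of divergence. *)
Definition append_ok (b : bool) v c : bool :=
  let A := orc v b.+1 in
  ((c == 0)%N ==> (A c == (npair b 0).+1)) &&
  ((0 < c)%N ==> (A c == (npair (nfst c.-1) (A (nsnd c.-1))).+1)).

Definition count_ok (w v : nat -> nat) m : bool :=
  ((nsnd m == 0)%N ==> (orc v 3 m == w (nfst m).*2)) &&
  ((0 < nsnd m)%N ==> (orc v 3 m ==
     orc v 3 (npair (orc v 1 (nfst m)) (nsnd m).-1) +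
     orc v 3 (npair (orc v 2 (nfst m)) (nsnd m).-1))%N).

Definition branch_ok (e : nat) v m : bool :=
  (orc v e 0 == 0)%N &&
  ((orc v e m.+1 == orc v 1 (orc v e m)) || (orc v e m.+1 == orc v 2 (orc v e m))).

(** Two limits are nested, over the depth [j] of the count and over the length [n] of the prefix.
    The moduli [M] and [N] turn them into one universal statement. *)
Definition conv_ok (z N M : nat) (q : nat) v m : bool :=
  let k := nfst m in let n := nfst (nsnd m) in let j := nsnd (nsnd m) in
  ((orc v N k <= n)%N && (orc v M (npair n k) <= j)%N) ==>
  close (orc v 3 (npair (orc v z n) j)) q j k.

Definition div_ok v m : bool :=
  let i := nfst m in let j := nsnd m in
  [&& (i <= orc v 11 i)%N, (i <= orc v 12 i)%N &
    (orc v 13 i <= j)%N ==> far (orc v 3 (npair (orc v 4 (orc v 11 i)) j))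
      (orc v 3 (npair (orc v 4 (orc v 12 i)) j)) j (orc v 0 1)].

(* [orc v 0 0] is the number of the disjunct of [formula_set] below that [v] witnesses. *)
Definition formula (cmax : nat) (w v : nat -> nat) m : bool :=
  [&& append_ok false v m, append_ok true v m, count_ok w v m,
      branch_ok 4 v m & branch_ok 5 v m] &&
  [&& (orc v 0 0 <= cmax)%N,
   (orc v 0 0 == 0)%N ==> (conv_ok 4 6 8 (w (nfst m).*2.+1) v m &&
       inside (w (orc v 0 1).*2.+1) (orc v 0 1)),
   (orc v 0 0 == 1)%N ==> below (w m.*2.+1) m,
   (orc v 0 0 == 2)%N ==> above (w m.*2.+1) m,
   (orc v 0 0 == 3)%N ==> div_ok v m
 & (orc v 0 0 == 4)%N ==>
     [&& conv_ok 4 6 8 (orc v 10 (nfst m)) v m, conv_ok 5 7 9 (orc v 10 (nfst m)) v m,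
      inside (orc v 10 (orc v 0 1)) (orc v 0 1) &
      orc v 4 (orc v 0 2) != orc v 5 (orc v 0 2)]].

Lemma OE_ext F G : OE F -> (forall w v m, F w v m = G w v m) -> OE G.
Proof.
move=> hF e; rewrite (_ : G = F) //.
by apply/funext => w; apply/funext => v; apply/funext => m.
Qed.

Lemma OE_and (P Q : (nat -> nat) -> (nat -> nat) -> nat -> bool) :
  OE (fun w v m => P w v m) -> OE (fun w v m => Q w v m) ->
  OE (fun w v m => P w v m && Q w v m).
Proof.
move=> hP hQ; apply: OE_ext (OE_comp2 PR2_mul hP hQ) _ => w v m.
by case: (P _ _ _); case: (Q _ _ _).
Qed.

Lemma OE_not (P : (nat -> nat) -> (nat -> nat) -> nat -> bool) :
  OE (fun w v m => P w v m) -> OE (fun w v m => ~~ P w v m).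
Proof.
move=> hP; apply: OE_ext (OE_comp2 PR2_sub (OE_const 1) hP) _ => w v m.
by case: (P _ _ _).
Qed.

Lemma OE_or (P Q : (nat -> nat) -> (nat -> nat) -> nat -> bool) :
  OE (fun w v m => P w v m) -> OE (fun w v m => Q w v m) ->
  OE (fun w v m => P w v m || Q w v m).
Proof.
move=> hP hQ; apply: OE_ext (OE_not (OE_and (OE_not hP) (OE_not hQ))) _ => w v m.
by rewrite negb_and !negbK.
Qed.

Lemma OE_imp (P Q : (nat -> nat) -> (nat -> nat) -> nat -> bool) :
  OE (fun w v m => P w v m) -> OE (fun w v m => Q w v m) ->
  OE (fun w v m => P w v m ==> Q w v m).
Proof.
move=> hP hQ; apply: OE_ext (OE_or (OE_not hP) hQ) _ => w v m.
by rewrite implybE.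
Qed.

Lemma OE_orc k F : OE F -> OE (fun w v m => orc v k (F w v m)).
Proof. by move=> hF; apply: OE_v; exact: (OE_comp2 PR2_npair (OE_const k)). Qed.

Ltac oe := repeat first
  [ exact: OE_arg | exact: OE_const | apply: OE_and | apply: OE_or | apply: OE_imp
  | apply: OE_not | apply: OE_orc | apply: OE_w
  | apply: (OE_comp1 PR1_succ) | apply: (OE_comp1 PR1_pred) | apply: (OE_comp1 PR1_double)
  | apply: (OE_comp1 PR1_nfst) | apply: (OE_comp1 PR1_nsnd) | apply: (OE_comp1 PR1_exp2)
  | apply: (OE_comp2 PR2_leq) | apply: (OE_comp2 PR2_eq) | apply: (OE_comp2 PR2_npair)
  | apply: (OE_comp2 PR2_add) | apply: (OE_comp2 PR2_mul) ].

Lemma OE_formula cmax : OE (fun w v m => formula cmax w v m).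
Proof.
rewrite /formula; apply: OE_and.
  by rewrite /append_ok /count_ok /branch_ok; oe.
by rewrite /conv_ok /div_ok /close /inside /below /above /far; oe.
Qed.

Lemma cvgto_near_unique (u : nat -> R) (l l' : R) (a : R) : 0 < a ->
  (forall k, `|u k - l| <= a * hp R k) -> (forall k, `|u k - l'| <= a * hp R k) -> l = l'.
Proof.
move=> a0 h h'; apply/eqP; rewrite -subr_eq0 -normr_eq0; apply/eqP/le_anti.
rewrite normr_ge0 andbT; apply/ler_addgt0Pr => e e0; rewrite add0r.
have [k ke] := hp_arch (divr_gt0 e0 (mulr_gt0 (ltr0Sn R 1) a0)).
have {}ke : 2%:R * a * hp R k < e by rewrite mulrC -ltr_pdivlMr // mulr_gt0.
rewrite (_ : l - l' = (u k - l') - (u k - l)); last by ring.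
apply: le_trans (ler_normB _ _) _; apply: le_trans (lerD (h' k) (h k)) _.
by rewrite -mulrDl -mulr2n -mulr_natl ltW.
Qed.

(** Letting [j] grow puts the densities within [2 hp k] of [q k] from length [N k] on, so they form
    a Cauchy sequence. In the formula for failing injectivity [q] is only guessed, and the common
    value [r] has to be recovered from it. *)
Lemma conv_elim (K : set cantor_space) (z : cantor_space) (q N : nat -> nat)
    (M : nat -> nat -> nat) : compact K ->
  (forall k n j, (N k <= n)%N -> (M n k <= j)%N ->
     `|freq R K (restr z n) j - qdec R (q k)| <= 2%:R * hp R k) ->
  exists2 r, DensityIs K z r & forall k, `|qdec R (q k) - r| <= 2%:R * hp R k.
Proof.
move=> cK h.
have near k n : (N k <= n)%N -> `|dens R K (restr z n) - qdec R (q k)| <= 2%:R * hp R k.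
  move=> kn; apply: (cvgto_dist_le (u := freq R K (restr z n)) (N := M n k)).
    by move=> e; exact: freq_near_dens.
  by move=> j; exact: h.
have [r hr] : exists r, cvgto (fun n => dens R K (restr z n)) r.
  apply: cvgto_complete => e e0.
  have [k ke] := hp_arch (divr_gt0 e0 (ltr0Sn R 3)).
  exists (N k) => m n /near h1 /near h2; move: h1 h2.
  rewrite !ler_norml => /andP[a b] /andP[c d]; apply/andP; split; lra.
exists r; first exact/DensityP.
move=> k; rewrite distrC; apply: (cvgto_dist_le (N := N k) hr) => n; exact: near.
Qed.

(** The tolerance [2 hp k] is spent as one [hp k] on the name of [r] and one half of it on each of
    the two limits. *)
Lemma conv_intro (K : set cantor_space) (z : cantor_space) (q : nat -> nat) (r : R) :
  compact K -> DensityIs K z r -> (forall k, `|qdec R (q k) - r| <= hp R k) ->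
  exists N : nat -> nat, exists M : nat -> nat -> nat,
    forall k n j, (N k <= n)%N -> (M n k <= j)%N ->
     `|freq R K (restr z n) j - qdec R (q k)| <= 2%:R * hp R k.
Proof.
move=> cK /DensityP zr hq.
have [N hN] := choice (fun k => zr _ (hp_gt0 R k.+1)).
have [M hM] := choice (fun nk : nat * nat => freq_near_dens (restr z nk.1) cK (hp_gt0 R nk.2.+1)).
exists N, (fun n k => M (n, k)) => k n j kn nkj.
have := hN k n kn; have := hM (n, k) j nkj; have := hq k; have := hpS R k.
rewrite /= !ler_norml !ltr_norml => a /andP[b c] /andP[d e] /andP[f g].
by apply/andP; split; lra.
Qed.

Lemma scode_inj : injective scode.
Proof.
elim=> [|a s IH] [|b t] //= [e]; have := congr1 nfst e; have := congr1 nsnd e.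
by rewrite !nfst_npair !nsnd_npair => /IH -> ->.
Qed.

Lemma bcode_inj : injective bcode.
Proof. by apply: inj_comp scode_inj _; apply: inj_map => -[] []. Qed.

Lemma scode_surj c : exists s, scode s = c.
Proof.
elim/ltn_ind: c => -[|c] IH; first by exists [::].
have [|s sE] := IH (nsnd c); first by rewrite ltnS -[X in (_ <= X)%N](npairK c) leq_nsnd_npair.
by exists (nfst c :: s); rewrite /= sE npairK.
Qed.

Lemma bcode_rcons (s : seq bool) b :
  bcode (rcons s b) = scode (rcons (map nat_of_bool s) b).
Proof. by rewrite /bcode map_rcons. Qed.

(** The tested equations are the recursion for appending a bit and so determine the oracle on every
    code; the formula checks these equations instead of computing the function. *)
Lemma append_okP v b s : (forall c, append_ok b v c) ->
  orc v b.+1 (scode s) = scode (rcons s b).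
Proof.
move=> h; elim: s => [|a s IH].
  by have := h 0%N; rewrite /append_ok /= => /andP[/eqP].
have := h (scode (a :: s)); rewrite /append_ok /= => /eqP ->.
by rewrite nfst_npair nsnd_npair IH.
Qed.

Lemma count_okP K w v s j : is_Kname K (fun n => w n.*2) ->
  (forall b c, append_ok b v c) -> (forall m, count_ok w v m) ->
  orc v 3 (npair (bcode s) j) = cnt K s j.
Proof.
move=> [nm _] ap h; elim: j s => [|j IH] s.
  have := h (npair (bcode s) 0); rewrite /count_ok nfst_npair nsnd_npair /=.
  move=> /andP[/eqP-> _].
  by rewrite nm /met; case: asbool.
have := h (npair (bcode s) j.+1); rewrite /count_ok nfst_npair nsnd_npair /= => /eqP ->.
rewrite -[orc v 1 _]/(orc v (false : nat).+1 _) -[orc v 2 _]/(orc v (true : nat).+1 _).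
by rewrite !append_okP // -!bcode_rcons !IH.
Qed.

Lemma branch_okP e v : (forall b c, append_ok b v c) -> (forall m, branch_ok e v m) ->
  exists z : cantor_space, forall n, orc v e n = bcode (restr z n).
Proof.
move=> ap h; pose z : cantor_space := fun n => orc v e n.+1 == orc v 2 (orc v e n).
exists z; elim=> [|n IH]; first by have /andP[/eqP] := h 0%N.
rewrite restrS bcode_rcons; have /andP[_] := h n.
have e1 (b : bool) : orc v b.+1 (orc v e n) = scode (rcons (map nat_of_bool (restr z n)) b).
  by rewrite IH append_okP.
rewrite -(e1 (z n)); have [zn _|] := boolP (z n); first exact/eqP.
by rewrite /z => /negbTE ->; rewrite orbF => /eqP.
Qed.

Lemma inside_intro (r : R) (q : nat -> nat) : 0 < r < 1 ->
  (forall k, `|qdec R (q k) - r| <= hp R k) -> exists p, inside (q p) p.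
Proof.
move=> /andP[r0 r1] hq.
(* [q p] needs the margin [2 hp p] and may be off by another [hp p]; with [hp p < e], four times [e]
   leaves room for strictness. *)
have [e [e0 e1 e2]] : exists e : R, [/\ 0 < e, 4%:R * e <= r & 4%:R * e <= 1 - r].
  by case: (leP r (1 - r)) => h; [exists (r / 4%:R)|exists ((1 - r) / 4%:R)]; split; lra.
have [p pe] := hp_arch e0; exists p; rewrite insideP.
by have := hq p; rewrite ler_norml => /andP[a b]; apply/andP; split; lra.
Qed.

Lemma inside_elim (r : R) q p : inside q p -> `|qdec R q - r| <= 2%:R * hp R p -> 0 < r < 1.
Proof.
rewrite insideP ler_norml => /andP[a b] /andP[c d]; apply/andP; split; lra.
Qed.

Lemma far_absurd (x y x' y' l e : R) : e <= `|x - y| -> `|y - y'| < e / 4%:R ->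
  `|x - x'| < e / 4%:R -> `|y' - l| < e / 4%:R -> `|x' - l| < e / 4%:R -> False.
Proof.
rewrite ler_normr !ltr_norml => a /andP[? ?] /andP[? ?] /andP[? ?] /andP[? ?].
by case/orP: a => ?; lra.
Qed.

Lemma qdec_dense (r : R) k : 0 <= r -> exists q, `|qdec R q - r| <= hp R k.
Proof.
move=> r0; exists (npair (Num.truncn (r * 2%:R ^+ k)) (npair 0 (2 ^ k).-1)).
have p0 : 0 < (2%:R : R) ^+ k by rewrite exprn_gt0.
rewrite /qdec !(nfst_npair, nsnd_npair) subr0 prednK ?expn_gt0 // natrX.
have /andP[h1 h2] := truncn_itv (mulr_ge0 r0 (ltW p0)).
set a := _%:R in h1 h2 *; have {}h1 : a / 2%:R ^+ k <= r by rewrite ler_pdivrMr.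
have {}h2 : r <= a / 2%:R ^+ k + hp R k.
  by rewrite /hp -[X in _ + X]mul1r -mulrDl ler_pdivlMr // natr1 ltW.
by rewrite ler_norml; apply/andP; split; have := hp_gt0 R k; lra.
Qed.

Lemma not_Sld_witness (K : set cantor_space) (z : cantor_space) : compact K ->
  ~ (exists r : R, DensityIs K z r) ->
  exists p (A B J : nat -> nat), forall i, [/\ (i <= A i)%N, (i <= B i)%N &
    forall j, (J i <= j)%N ->
      hp R p <= `|freq R K (restr z (A i)) j - freq R K (restr z (B i)) j|].
Proof.
move=> cK nz.
have [e [e0 ne]] : exists e : R, 0 < e /\ forall N, exists mn : nat * nat,
    [/\ (N <= mn.1)%N, (N <= mn.2)%N &
    e < `|dens R K (restr z mn.1) - dens R K (restr z mn.2)|].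
  apply: contrapT => nex; apply: nz; suff [r zr] : exists r, cvgto (fun n => dens R K (restr z n)) r.
    by exists r; apply/DensityP.
  apply: cvgto_complete => e e0; apply: contrapT => nN; apply: nex; exists e; split=> // N.
  apply: contrapT => nmn; apply: nN; exists N => m n Nm Nn.
  rewrite leNgt; apply/negP => lt; apply: nmn; by exists (m, n).
have [p pe] := hp_arch e0.
have [mn hmn] := choice ne.
have [J hJ] := choice (fun s => freq_near_dens s cK (hp_gt0 R p.+2)).
(* The densities differ by more than [hp p], and each count is off by less than a quarter of [hp p];
   half of it, [hp p.+1], remains. *)
exists p.+1, (fun i => (mn i).1), (fun i => (mn i).2),
  (fun i => maxn (J (restr z (mn i).1)) (J (restr z (mn i).2))) => i.
have [h1 h2 lt] := hmn i; split=> // j; rewrite geq_max => /andP[/hJ a /hJ b].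
move: a b lt pe; rewrite (hpS R p) (hpS R p.+1).
move: (freq _ _ _ _) (freq _ _ _ _) (dens _ _ _) (dens _ _ _) (hp _ _) => x y x' y' u.
rewrite !ltr_norml ltr_normr ler_normr => /andP[? ?] /andP[? ?] c ?.
by case/orP: c => ?; apply/orP; [left|right]; lra.
Qed.

(** Here [r] ranges over all reals. The bound [cmax] cuts the list: 0 leaves [U], 2 gives the
    complement of [Uc], and 4 the complement of the set in (c), so that one formula serves all three
    complexity claims. *)
Definition formula_set (cmax : nat) (K : set cantor_space) (r : R) : Prop :=
  [\/ U K r, (1 <= cmax)%N /\ r <= 0, (2 <= cmax)%N /\ 1 <= r
    | ((3 <= cmax)%N /\ ~ Sld R K) \/ ((4 <= cmax)%N /\ ~ Rng_inj R K)].

(** * Soundness and completeness of the formula *)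

Section Correctness.
Variables (K : set cantor_space) (r : R) (w : nat -> nat).
Hypotheses (cK : compact K) (nm : is_name K r w).

Let Knm : is_Kname K (fun n => w n.*2). Proof. by case: nm. Qed.
Let qr k := w k.*2.+1.
Let rnm k : `|qdec R (qr k) - r| <= hp R k. Proof. by case: nm => _; apply. Qed.

Let conv_okE v z N M (q : nat -> nat) y :
  (forall n, orc v z n = bcode (restr y n)) ->
  (forall s j, orc v 3 (npair (bcode s) j) = cnt K s j) ->
  (forall m, conv_ok z N M (q (nfst m)) v m) <->
  (forall k n j, (orc v N k <= n)%N -> (orc v M (npair n k) <= j)%N ->
    `|freq R K (restr y n) j - qdec R (q k)| <= 2%:R * hp R k).
Proof.
move=> hz hc; split=> [h k n j kn nkj|h m].
  have := h (npair k (npair n j)).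
  by rewrite /conv_ok !(nfst_npair, nsnd_npair) kn nkj /= hz hc closeP.
rewrite /conv_ok; apply/implyP => /andP[/h h1 /h1].
by rewrite hz hc closeP.
Qed.

Lemma formula_sound cmax v : (cmax <= 4)%N -> (forall m, formula cmax w v m) ->
  formula_set cmax K r.
Proof.
move=> c4 h.
have ap b c : append_ok b v c.
  by have /andP[/and5P[h1 h2 _ _ _] _] := h c; case: b.
have hc s j : orc v 3 (npair (bcode s) j) = cnt K s j.
  by apply: (count_okP (w := w)) => // m; have /andP[/and5P[]] := h m.
have [z0 hz0] : exists z : cantor_space, forall n, orc v 4 n = bcode (restr z n).
  by apply: branch_okP => // m; have /andP[/and5P[]] := h m.
have [z1 hz1] : exists z : cantor_space, forall n, orc v 5 n = bcode (restr z n).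
  by apply: branch_okP => // m; have /andP[/and5P[]] := h m.
have {}h m := andP (proj2 (andP (h m))).
move: h; set c := orc v 0 0; case: c => [|[|[|[|[|c']]]]] h.
- constructor 1; have /(conv_okE _ _ qr hz0 hc) cv : forall m, conv_ok 4 6 8 (qr (nfst m)) v m.
    by move=> m; have [_ /andP[/andP[]]] := h m.
  have [r' zr' hr'] := conv_elim (N := orc v 6) (M := fun n k => orc v 8 (npair n k)) cK cv.
  have rr : r = r'.
    apply: (cvgto_near_unique (u := fun k => qdec R (qr k)) (ltr0Sn R 1)) => // k.
    by apply: le_trans (rnm k) _; have := hp_gt0 R k; lra.
  split; last by exists z0; rewrite rr.
  have [_ /andP[/andP[_ ins] _]] := h 0%N; apply: inside_elim ins _.
  by rewrite rr; exact: hr'.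
- constructor 2; split; first by have [] := h 0%N.
  apply/ler_addgt0Pr => e e0; have [k ke] := hp_arch (divr_gt0 e0 (ltr0Sn R 1)).
  have [_ /and5P[_ + _ _ _]] := h k; rewrite /= belowP.
  by have := rnm k; rewrite ler_norml => /andP[a b] d; lra.
- constructor 3; split; first by have [] := h 0%N.
  apply/ler_addgt0Pr => e e0; have [k ke] := hp_arch (divr_gt0 e0 (ltr0Sn R 1)).
  have [_ /and5P[_ _ + _ _]] := h k; rewrite /= aboveP.
  by have := rnm k; rewrite ler_norml => /andP[a b] d; lra.
- constructor 4; left; split; first by have [] := h 0%N.
  move=> /(_ z0)[l /DensityP zl].
  have dv i j : [/\ (i <= orc v 11 i)%N, (i <= orc v 12 i)%N & (orc v 13 i <= j)%N ->
      hp R (orc v 0 1) <= `|freq R K (restr z0 (orc v 11 i)) j - freq R K (restr z0 (orc v 12 i)) j|].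
    have [_ /and5P[_ _ _ + _]] := h (npair i j).
    move=> /implyP/(_ isT); rewrite /div_ok nfst_npair nsnd_npair !hz0 !hc.
    move=> /and3P[ai bi /implyP dv].
    by split=> // /dv; rewrite farP.
  (* Two counts, each within a quarter of the gap of its density, and two densities, each within a
     quarter of the limit [l], cannot be a whole gap apart. *)
  have p4 : 0 < hp R (orc v 0 1) / 4%:R by rewrite divr_gt0 ?hp_gt0.
  have [N hN] := zl _ p4; have [Ai Bi _] := dv N 0%N.
  have [J hJ] := freq_near_dens (restr z0 (orc v 11 N)) cK p4.
  have [J' hJ'] := freq_near_dens (restr z0 (orc v 12 N)) cK p4.
  pose j := (orc v 13 N + J + J')%N; have [_ _ hj] := dv N j.
  have := hN _ Ai; have := hN _ Bi; have := hJ j; have := hJ' j; have := hj.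
  rewrite /j !(leq_addl, leq_addr) -addnA leq_addr addnCA leq_addr.
  by move=> /(_ isT) + /(_ isT) + /(_ isT); exact: far_absurd.
- constructor 4; right; split; first by have [] := h 0%N.
  pose q k := orc v 10 k => inj.
  have [_ /and5P[_ _ _ _ /and4P[_ _ ins ne]]] := h 0%N.
  have /(conv_okE _ _ q hz0 hc) cv0 : forall m, conv_ok 4 6 8 (q (nfst m)) v m.
    by move=> m; have [_ /and5P[_ _ _ _ /and4P[]]] := h m.
  have /(conv_okE _ _ q hz1 hc) cv1 : forall m, conv_ok 5 7 9 (q (nfst m)) v m.
    by move=> m; have [_ /and5P[_ _ _ _ /and4P[]]] := h m.
  have [r0 zr0 h0] := conv_elim (N := orc v 6) (M := fun n k => orc v 8 (npair n k)) cK cv0.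
  have [r1 zr1 h1] := conv_elim (N := orc v 7) (M := fun n k => orc v 9 (npair n k)) cK cv1.
  have rr := cvgto_near_unique (ltr0Sn R 1) h0 h1.
  rewrite -rr in zr1; have := inj _ _ _ zr0 zr1 (inside_elim ins (h0 _)) => zz.
  by move: ne; rewrite hz0 hz1 zz eqxx.
- by have [/leq_trans/(_ c4)] := h 0%N.
Qed.

Let sdec := projT1 (choice scode_surj).

Let sdecK s : sdec (scode s) = s.
Proof. by apply: scode_inj; exact: (projT2 (choice scode_surj)). Qed.

Let appendf (b : bool) c := scode (rcons (sdec c) b).

Let countf := fix F c j : nat :=
  if j is j'.+1 then (F (appendf false c) j' + F (appendf true c) j')%N else w c.*2.

(** Witnesses for all disjuncts are assembled into one function; only those of disjunct [c] have to
    be meaningful, the others are arbitrary. *)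
Lemma formula_complete cmax c (par : nat -> nat) (z0 z1 : cantor_space)
    (N0 N1 : nat -> nat) (M0 M1 : nat -> nat -> nat) (q A B J : nat -> nat) :
  (c <= cmax)%N ->
  (c = 0%N -> (forall k n j, (N0 k <= n)%N -> (M0 n k <= j)%N ->
      `|freq R K (restr z0 n) j - qdec R (qr k)| <= 2%:R * hp R k) /\
    inside (qr (par 0%N)) (par 0%N)) ->
  (c = 1%N -> r <= 0) -> (c = 2 -> 1 <= r) ->
  (c = 3 -> forall i, [/\ (i <= A i)%N, (i <= B i)%N &
    forall j, (J i <= j)%N ->
      hp R (par 0%N) <= `|freq R K (restr z0 (A i)) j - freq R K (restr z0 (B i)) j|]) ->
  (c = 4 -> [/\ forall k n j, (N0 k <= n)%N -> (M0 n k <= j)%N ->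
      `|freq R K (restr z0 n) j - qdec R (q k)| <= 2%:R * hp R k,
    forall k n j, (N1 k <= n)%N -> (M1 n k <= j)%N ->
      `|freq R K (restr z1 n) j - qdec R (q k)| <= 2%:R * hp R k,
    inside (q (par 0%N)) (par 0%N) & restr z0 (par 1%N) <> restr z1 (par 1%N)]) ->
  exists v, forall m, formula cmax w v m.
Proof.
move=> ccmax h0 h1 h2 h3 h4.
(* The zeroth function starts with [c], followed by the parameters: a precision, and a length at
   which the prefixes of the two points differ. *)
pose f k : nat -> nat := nth (fun=> 0%N) [:: (fun i => if i is i'.+1 then par i' else c);
  appendf false; appendf true; (fun m => countf (nfst m) (nsnd m));
  (fun n => bcode (restr z0 n)); (fun n => bcode (restr z1 n)); N0; N1;
  (fun m => M0 (nfst m) (nsnd m)); (fun m => M1 (nfst m) (nsnd m)); q; A; B; J] k.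
pose v i := f (nfst i) (nsnd i).
have vE k i : orc v k i = f k i by rewrite /orc /v nfst_npair nsnd_npair.
have ap b m : append_ok b v m.
  rewrite /append_ok !vE; have [s <-] := scode_surj m.
  have fE : f b.+1 = appendf b by case: b.
  rewrite fE /appendf; case: s => [|a s]; rewrite ?sdecK /=.
    by rewrite eqxx.
  by rewrite nfst_npair nsnd_npair sdecK.
have ct m : count_ok w v m.
  rewrite /count_ok !vE /f /= !(nfst_npair, nsnd_npair).
  by case: (nsnd m) => [|j] /=; rewrite eqxx.
have hc s j : orc v 3 (npair (bcode s) j) = cnt K s j.
  by apply: (count_okP (w := w)).
have hz0 n : orc v 4 n = bcode (restr z0 n) by rewrite vE.
have hz1 n : orc v 5 n = bcode (restr z1 n) by rewrite vE.
have br e (z : cantor_space) m : (forall n, orc v e n = bcode (restr z n)) -> branch_ok e v m.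
  move=> hz; rewrite /branch_ok !hz /= restrS bcode_rcons.
  rewrite -[orc v 1 _]/(orc v (false : nat).+1 _) -[orc v 2 _]/(orc v (true : nat).+1 _).
  by rewrite !append_okP //; case: (z m); rewrite eqxx ?orbT.
exists v => m; rewrite /formula; apply/andP; split.
  by rewrite !ap ct (br _ z0) // (br _ z1).
have v00 : orc v 0 0 = c by rewrite vE.
have v01 : orc v 0 1 = par 0%N by rewrite vE.
have v02 : orc v 0 2 = par 1%N by rewrite vE.
have M0E n k : orc v 8 (npair n k) = M0 n k by rewrite vE /f /= nfst_npair nsnd_npair.
have M1E n k : orc v 9 (npair n k) = M1 n k by rewrite vE /f /= nfst_npair nsnd_npair.
rewrite v00 v01 v02 ccmax /=; apply/and5P; split; apply/implyP => /eqP cE.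
- have [cv ins] := h0 cE; rewrite ins andbT.
  apply: ((conv_okE 6 8 qr hz0 hc).2 _ m) => k n j.
  by rewrite M0E vE; exact: cv.
- rewrite belowP; have := rnm m; have := h1 cE.
  by rewrite ler_norml => a /andP[b d]; lra.
- rewrite aboveP; have := rnm m; have := h2 cE.
  by rewrite ler_norml => a /andP[b d]; lra.
- have [a b d] := h3 cE (nfst m).
  rewrite /div_ok !(vE 11) !(vE 12) (vE 13) v01 /f /= a b /=; apply/implyP => /d.
  by rewrite farP -/f !hz0 !hc.
- have v10 i : orc v 10 i = q i by rewrite vE.
  have [cv0 cv1 ins ne] := h4 cE; rewrite !v10 hz0 hz1 (inj_eq bcode_inj) (introN eqP ne) andbT.
  apply/and3P; split=> //.
    apply: ((conv_okE 6 8 q hz0 hc).2 _ m) => k n j.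
    by rewrite M0E vE; exact: cv0.
  apply: ((conv_okE 7 9 q hz1 hc).2 _ m) => k n j.
  by rewrite M1E vE; exact: cv1.
Qed.

Lemma formula_setE cmax : (cmax <= 4)%N ->
  formula_set cmax K r <-> exists v, forall m, formula cmax w v m.
Proof.
move=> c4; split; last by move=> [v]; exact: formula_sound.
pose o := fun _ : nat => 0%N; pose oo := fun _ _ : nat => 0%N.
pose zz : cantor_space := fun=> false.
case=> [[r01 [z zr]]|[c1 r0]|[c2 r1]|[[c3 nS]|[c4' nI]]].
- have [N [M cv]] := conv_intro cK zr rnm; have [p ins] := inside_intro r01 rnm.
  by apply: (@formula_complete cmax 0 (fun=> p) z zz N o M oo o o o o).
- by apply: (@formula_complete cmax 1 o zz zz o o oo oo o o o o).
- by apply: (@formula_complete cmax 2 o zz zz o o oo oo o o o o).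
- have [z nz] : exists z : cantor_space, ~ exists r : R, DensityIs K z r.
    by apply: contrapT => nex; apply: nS => z; apply: contrapT => nz; apply: nex; exists z.
  have [p [A [B [J h]]]] := not_Sld_witness cK nz.
  by apply: (@formula_complete cmax 3 (fun=> p) z zz o o oo oo o A B J).
- have [z0 [z1 [s [zs0 zs1 s01 ne]]]] : exists z0 z1 (s : R),
      [/\ DensityIs K z0 s, DensityIs K z1 s, 0 < s < 1 & z0 <> z1].
    apply: contrapT => nex; apply: nI => z0 z1 s zs0 zs1 s01.
    by apply: contrapT => ne; apply: nex; exists z0, z1, s.
  have s0 : 0 <= s by case/andP: s01 => /ltW.
  have [q hq] := choice (fun k => qdec_dense k s0).
  have [N0 [M0 cv0]] := conv_intro cK zs0 hq; have [N1 [M1 cv1]] := conv_intro cK zs1 hq.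
  have [p ins] := inside_intro s01 hq.
  have [i nei] : exists i, z0 i <> z1 i.
    apply: contrapT => nex; apply: ne; apply/funext => i.
    by apply: contrapT => nei; apply: nex; exists i.
  (* The prefixes are compared at length [i.+1], the first that contains the differing bit [i]. *)
  apply: (@formula_complete cmax 4 (fun k => if k is 0%N then p else i.+1)
    z0 z1 N0 N1 M0 M1 q o o o) => // _; split=> //= e.
  by apply: nei; move: e; rewrite !restrS => /eqP; rewrite eqseq_rcons => /andP[_ /eqP].
Qed.

End Correctness.

Lemma Sigma11_formula_set cmax : (cmax <= 4)%N -> Sigma11 (formula_set cmax).
Proof.
move=> c4; apply: (Sigma11_intro (OE_formula cmax)) => K r w cK nm.
rewrite (formula_setE cK nm c4); split=> -[v hv]; exists v => m.
  by rewrite hv.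
by have := hv m; case: formula.
Qed.

Lemma Sigma11_ext (A B : set cantor_space -> R -> Prop) :
  (forall K r, A K r <-> B K r) -> Sigma11 A -> Sigma11 B.
Proof. by move=> AB [f hf]; exists f => K r w cK nm; rewrite -AB; exact: hf. Qed.

Lemma Sigma11_U : Sigma11 (@U R).
Proof.
apply: Sigma11_ext (Sigma11_formula_set (isT : 0 <= 4)%N) => K r.
by split=> [[//|[]|[]|[[]|[]]]|u] //; constructor 1.
Qed.

Lemma Pi11_Uc : Pi11 (@Uc R).
Proof.
apply: Sigma11_ext (Sigma11_formula_set (isT : 2 <= 4)%N) => K r.
split=> [[u [_ nu]|[_ r0] [/andP[a _] _]|[_ r1] [/andP[_ b] _]|[[]|[]]] //|nU].
- by rewrite ltNge r0 in a.
- by rewrite ltNge r1 in b.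
have [r0|r0] := leP r 0; first by constructor 2.
have [r1|r1] := leP 1 r; first by constructor 3.
constructor 1; apply: contrapT => nu; apply: nU; split=> //.
by rewrite r0 r1.
Qed.

Lemma Pi11_Uc_solid_injective :
  Pi11 (fun (K : set cantor_space) (r : R) => Sld R K /\ Rng_inj R K /\ Uc K r).
Proof.
apply: Sigma11_ext (Sigma11_formula_set (isT : 4 <= 4)%N) => K r.
split=> [h [sK [iK [/andP[a b] nu]]]|nh].
  case: h => [//|[_ r0]|[_ r1]|[[_]|[_]]] //.
    by rewrite ltNge r0 in a.
  by rewrite ltNge r1 in b.
have [sK|nsK] := pselect (Sld R K); last by constructor 4; left.
have [iK|niK] := pselect (Rng_inj R K); last by constructor 4; right.
have [r0|r0] := leP r 0; first by constructor 2.
have [r1|r1] := leP 1 r; first by constructor 3.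
constructor 1; apply: contrapT => nu; apply: nh; do !split=> //.
by rewrite r0 r1.
Qed.

End Formula.


Theorem theorem5p4 (R : realType) :
  (* (a) *)
  (Sigma11 (@U R) /\
   (forall K : set cantor_space, compact K -> analytic01 (@Usec R K)) /\
   (forall S : set R, analytic01 S ->
      exists K : set cantor_space, compact K /\ @Usec R K = S) /\
   Pi11 (@Uc R) /\
   (forall K : set cantor_space, compact K -> coanalytic01 (@Ucsec R K)) /\
   (forall P : set R, coanalytic01 P ->
      exists K : set cantor_space, compact K /\ @Ucsec R K = P)) /\
  (* (b) *)
  ((forall S : set R, analytic01 S ->
      exists K : set cantor_space, compact K /\ Sld R K /\ @Usec R K = S) /\
   (forall P : set R, coanalytic01 P ->
      exists K : set cantor_space, compact K /\ Sld R K /\ @Ucsec R K = P)) /\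
  (* (c) *)
  ((forall K : set cantor_space, compact K -> Sld R K -> Rng_inj R K ->
      borel01 (@Usec R K)) /\
   (forall B : set R, borel01 B ->
      exists K : set cantor_space,
        compact K /\ Sld R K /\ Rng_inj R K /\ @Usec R K = B) /\
   Pi11 (fun (K : set cantor_space) (r : R) => Sld R K /\ Rng_inj R K /\ Uc K r) /\
   (forall K : set cantor_space, compact K -> Sld R K -> Rng_inj R K ->
      borel01 (@Ucsec R K)) /\
   (forall B : set R, borel01 B ->
      exists K : set cantor_space,
        compact K /\ Sld R K /\ Rng_inj R K /\ @Ucsec R K = B)).
Proof.
have noSld (Q : set R -> set cantor_space -> Prop) (S : set R) :
    (exists K, compact K /\ Sld R K /\ Q S K) -> exists K, compact K /\ Q S K.
  by move=> [K [cK [_ q]]]; exists K.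
split; [|split].
- split; first exact: Sigma11_U.
  split; first by move=> K _; exact: Usec_analytic.
  split.
    move=> S /analytic_realized; exact: (noSld (fun S K => @Usec R K = S)).
  split; first exact: Pi11_Uc.
  split; first by move=> K _; exact: Ucsec_coanalytic.
  move=> P /coanalytic_realized; exact: (noSld (fun S K => @Ucsec R K = S)).
- by split; [exact: analytic_realized|exact: coanalytic_realized].
- split; first by move=> K _ _; exact: Usec_borel.
  split; first exact: borel_realized.
  split; first exact: Pi11_Uc_solid_injective.
  split; first by move=> K _ _; exact: Ucsec_borel.
  exact: coborel_realized.
Qed.
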